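(* Let $t>1$, $s>t$ and $\tau=1+s/t$. Let $D_{s,t}=\{x\in\mathbb R\setminus\mathbb Q:\ \sum_{n\ge1}n^{-s}|\sin(\pi nx)|^{-t}=+\infty\}$, and for $\kappa\in\mathbb R$ let $h_\kappa$ be the dimension function given for small $r>0$ by $h_\kappa(r)=r^{2/\tau}(\log(1/r))^{\kappa}$. Then the Hausdorff $h_\kappa$-measure of $D_{s,t}$ satisfies $$\mathcal H^{h_\kappa}(D_{s,t})=\begin{cases}0,&\kappa<-1,\\ \infty,&\kappa\ge-1.\end{cases}$$
   Context: $h_\kappa(r)=r^{2/\tau}(\log(1/r))^{\kappa}$ for $0<r<r_0$, with $r_0$ (depending on $\kappa,\tau$) small enough that $h_\kappa$ is increasing there with $h_\kappa(0^+)=0$, extended arbitrarily and monotonically to $[r_0,\infty)$. For a dimension function $h$, $\mathcal H^{h}(A)=\lim_{\delta\to0}\inf\{\sum_i h(\operatorname{diam}U_i): A\subseteq\bigcup_iU_i\text{ countable cover},\ \operatorname{diam}U_i\le\delta\}$ for $A\subseteq\mathbb R$. *)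

(* Defs.v *)
From HB Require Import structures.
From mathcomp Require Import all_boot all_order all_algebra.
From mathcomp Require Import all_classical all_reals all_analysis.
Import Order.TTheory GRing.Theory Num.Theory.
Import numFieldNormedType.Exports.

Set Implicit Arguments.
Unset Strict Implicit.
Unset Printing Implicit Defensive.

Local Open Scope classical_set_scope.
Local Open Scope ring_scope.

(* The value 0 is adjoined so that diam set0 = 0, and the supremum is taken in
   \bar R so that unbounded sets have diameter +oo (the real-valued [sup] would
   give them the junk value 0). *)
Definition diam (R : realType) (U : set R) : \bar R :=
  ereal_sup (0%E |` [set (`|x - y|)%:E | x in U & y in U]).

Definition delta_cover (R : realType) (delta : R) (A : set R) :
    set ((set R)^nat) :=
  [set U | A `<=` \bigcup_i U i /\ forall i, (diam (U i) <= delta%:E)%E].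

(* Covers are sequences; since diam set0 = 0 and h 0 = 0 for a dimension
   function, finite covers are included by padding with set0. *)
Definition hausdorff_pre (R : realType) (h : R -> R) (delta : R) (A : set R) :
    \bar R :=
  ereal_inf [set (\sum_(0 <= i <oo) (h (fine (diam (U i))))%:E)%E |
              U in delta_cover delta A].

Definition hausdorff_measure (R : realType) (h : R -> R) (A : set R) : \bar R :=
  lim (hausdorff_pre h delta A @[delta --> 0^'+]).

(* The limit above always exists, so that [lim] is meaningful. *)
Lemma is_cvg_hausdorff_pre (R : realType) (h : R -> R) (A : set R) :
  cvg (hausdorff_pre h delta A @[delta --> 0^'+]).
Proof.
apply: nonincreasing_at_right_is_cvge.
near=> y => d1 d2 _ _ d12.
apply: ereal_inf_le_tmp => _ [U [AU dU] <-].
exists U => //; split => // i.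
by apply: le_trans (dU i) _; rewrite lee_fin.
Unshelve. all: by end_near. Qed.

(* Only the values on [0, +oo[ matter. *)
Definition dimension_function (R : realType) (h : R -> R) : Prop :=
  [/\ h 0 = 0,
      {in `[0, +oo[ &, {homo h : x y / x <= y}} &
      h r @[r --> 0^'+] --> (0 : R)].

Definition log_gauge (R : realType) (tau kappa r : R) : R :=
  r `^ (2 / tau) * (ln (1 / r)) `^ kappa.

(* h is an arbitrary monotone extension of the germ at 0 of [log_gauge];
   r0 <= 1 makes the base [ln (1 / r)] of the real power positive. *)
Definition log_dimension_function (R : realType) (tau kappa : R) (h : R -> R) :
    Prop :=
  dimension_function h /\
  exists r0 : R, [/\ 0 < r0, r0 <= 1,
    {in `]0, r0[ &, {homo log_gauge tau kappa : x y / x < y}} &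
    {in `]0, r0[, h =1 log_gauge tau kappa}].

Definition Dset (R : realType) (s t : R) : set R :=
  [set x | irrational x /\
    (\sum_(1 <= n <oo)
       (n%:R `^ (- s) * `|sin (pi * n%:R * x)| `^ (- t))%:E = +oo)%E].

(* Main.v *)
Require Import Defs.
From HB Require Import structures.
From mathcomp Require Import all_boot all_order all_algebra.
From mathcomp Require Import all_classical all_reals all_analysis.
From mathcomp Require Import zify ring lra.
Set Implicit Arguments.
Unset Strict Implicit.
Unset Printing Implicit Defensive.

Import Order.TTheory GRing.Theory Num.Theory.
Import numFieldNormedType.Exports.
Local Open Scope classical_set_scope.
Local Open Scope ring_scope.

(** Infinite measure. If |x - p/q| <= q^(-tau) then the q-th term of the series is at
    least pi^(-t), so D contains the irrational numbers that are infinitely often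
    approximated with exponent tau. Given a cover with finite sum of h over the
    diameters, nested balls around fractions are chosen so that the elements of the
    cover touching them have total weight at most theta times that of the ball. A next
    ball exists because the weights of the fractions of size 32^n add up to 1/n on each
    interval, up to a constant, and the harmonic series diverges. The common point of
    the balls lies in D and in no element of the cover.

    Null measure. Let delta_m be the minimum of ||q x|| for 0 < q < 2^m. By separation
    of the points q x modulo 1, the dyadic block of the series ending at 2^m is at most
    a constant times b_m = 2^(-m s) delta_m^(-t). If delta_m >= 2^(-m s/t) m^eps
    eventually, then b_m <= m^(-eps t), and since delta_m can only drop when it is at
    least 2^(-m)/3, the large b_m occur along geometrically growing sequences of m,
    whose sum is finite. So for x in D the reverse inequality holds infinitely
    often, and for small eps the resulting covers by intervals around fractions have
    convergent h-sums when kappa < -1. *)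

(** * Separation and counting of fractions *)

(** The infinite half is run for [kappa = -1] only, since for small [r] the gauge increases with
    [kappa]. What must stay small from ball to ball is the total length of the cover elements
    touching the current ball: an element larger than the child balls can touch a number of them
    proportional to its length. The bound [S] on their total weight may be arbitrary, because
    smaller elements cost at most [S / theta] altogether while the weight available in children is
    unbounded; this is why the measure is infinite and not merely positive. A child whose touching
    elements have small weight also has small touching length, since [g x / x] is nonincreasing near
    0.

    In the null half, the threshold without [m^eps] would only give [b_m <= 1], and a sum along
    geometrically growing indices could still diverge. The price of [m^eps] is a factor
    [m^(2 eps / tau)] in the [m]-th sum of the cover, for which the strict inequality [kappa < -1]
    leaves room. *)

Lemma size_separated (R : realType) (s : seq R) (a b d : R) :
  0 < d -> a <= b -> uniq s -> {in s, forall x, a <= x <= b} ->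
  {in s &, forall x y, x != y -> d <= `|x - y|} ->
  (size s)%:R <= 1 + (b - a) / d.
Proof.
move=> d0 ab us sab sep.
pose f x := Num.truncn ((x - a) / d).
have f_itv x : x \in s -> (f x)%:R <= (x - a) / d < (f x).+1%:R.
  move=> /sab /andP[ax xb]; apply: truncn_itv.
  by rewrite divr_ge0 ?subr_ge0// ltW.
have finj : {in s &, injective f}.
  move=> x y xs ys fxy; apply/eqP/negPn/negP => /(sep _ _ xs ys).
  have /andP[] := f_itv _ xs; have /andP[] := f_itv _ ys; rewrite fxy -addn1 natrD.
  rewrite !ler_pdivlMr// !ltr_pdivrMr// => h1 h2 h3 h4.
  by apply/negP; rewrite -ltNge ltr_norml; apply/andP; split; lra.
have : (size (map f s) <= (Num.truncn ((b - a) / d)).+1)%N.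
  rewrite -(size_iota 0 (Num.truncn ((b - a) / d)).+1); apply: uniq_leq_size.
    by rewrite map_inj_in_uniq.
  move=> _ /mapP[x xs ->]; rewrite mem_iota add0n ltnS /=.
  apply: le_truncn; rewrite ler_pM2r ?invr_gt0// lerD2r.
  by case/andP: (sab _ xs).
rewrite size_map -(ler_nat R) => /le_trans; apply.
rewrite -addn1 natrD addrC lerD2l truncn_le.
by rewrite divr_ge0 ?subr_ge0// ltW.
Qed.

(** Since [x] belongs to the separated family without being counted, it absorbs the additive 1 of
    [size_separated]. A bound proportional to [l] is essential in [size_sparse_ge], where it is
    summed over all points of many levels. *)
Lemma size_separated_around (R : realType) (s : seq R) (x l d : R) :
  0 < d -> 0 <= l -> uniq s -> x \notin s -> {in s, forall y, `|y - x| <= l} ->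
  {in x :: s &, forall y z, y != z -> d <= `|y - z|} ->
  (size s)%:R <= 2 * l / d.
Proof.
move=> d0 l0 us xs sl sep.
have := @size_separated R (x :: s) (x - l) (x + l) d d0.
have -> : x + l - (x - l) = 2 * l by ring.
rewrite /= -natr1 [1 + _]addrC lerD2r; apply.
- by lra.
- by rewrite /= xs us.
- move=> y; rewrite inE => /orP[/eqP->|/sl]; first by apply/andP; split; lra.
  by rewrite ler_norml => /andP[? ?]; apply/andP; split; lra.
- by move=> y z ys zs; apply: sep.
Qed.

Definition fracs (R : realType) (P Q : nat) : seq R :=
  undup [seq p%:R / q%:R | q <- index_iota P Q,
                           p <- [seq p <- iota 0 q.+1 | coprime p q]].

Lemma fracsP (R : realType) (P Q : nat) (x : R) :
  reflect (exists p q, [/\ (P <= q < Q)%N, (p <= q)%N, coprime p q & x = p%:R / q%:R])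
    (x \in fracs R P Q).
Proof.
rewrite mem_undup; apply: (iffP allpairsPdep).
  move=> [q [p [qPQ]]]; rewrite mem_filter mem_iota add0n ltnS => /and3P[pq _ lpq] ->.
  by exists p, q; split=> //; rewrite mem_index_iota in qPQ.
move=> [p [q [qPQ lpq pq ->]]]; exists q, p; split=> //.
  by rewrite mem_index_iota.
by rewrite mem_filter pq mem_iota ltnS.
Qed.

Lemma fracs_uniq (R : realType) P Q : uniq (fracs R P Q).
Proof. exact: undup_uniq. Qed.

Lemma frac_separated (R : realType) (p q p' q' : nat) :
  (0 < q)%N -> (0 < q')%N -> p%:R / q%:R != p'%:R / q'%:R :> R ->
  (q%:R * q'%:R)^-1 <= `|p%:R / q%:R - p'%:R / q'%:R| :> R.
Proof.
move=> q0 q'0 ne.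
have q0R : (q%:R : R) != 0 by rewrite pnatr_eq0 -lt0n.
have q'0R : (q'%:R : R) != 0 by rewrite pnatr_eq0 -lt0n.
have -> : p%:R / q%:R - p'%:R / q'%:R =
   ((p * q')%:Z - (p' * q)%:Z)%:~R / (q%:R * q'%:R) :> R.
  by rewrite intrB -!pmulrn !natrM; field; rewrite q0R q'0R.
rewrite normrM normfV (ger0_norm (mulr_ge0 _ _))// ler_peMl ?invr_ge0 ?mulr_ge0//.
rewrite -intr_norm -[1]/(1%:~R) ler_int -gtz0_ge1 normr_gt0 subr_eq0.
apply: contra ne => /eqP[] /(congr1 (fun n => n%:R : R)); rewrite !natrM => e.
by rewrite eqr_div// e.
Qed.

Lemma coprime_frac_inj (R : realType) (p q p' q' : nat) :
  (0 < q)%N -> (0 < q')%N -> coprime p q -> coprime p' q' ->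
  p%:R / q%:R = p'%:R / q'%:R :> R -> p = p' /\ q = q'.
Proof.
move=> q0 q'0 cpq cpq' /eqP; rewrite eqr_div ?pnatr_eq0 -?lt0n// -!natrM eqr_nat.
move=> /eqP e.
have qq' : q = q'.
  apply/eqP; rewrite eqn_dvd; apply/andP; split.
    by rewrite -(Gauss_dvdr _ (m := q) (n := p)) ?e ?dvdn_mull// coprime_sym.
  by rewrite -(Gauss_dvdr _ (m := q') (n := p')) -?e ?dvdn_mull// coprime_sym.
by split=> //; move: e; rewrite qq' => /eqP; rewrite eqn_pmul2r// => /eqP.
Qed.

Lemma fracs_separated (R : realType) (P Q P' Q' : nat) (x y : R) :
  (0 < P)%N -> (0 < P')%N -> x \in fracs R P Q -> y \in fracs R P' Q' -> x != y ->
  (Q%:R * Q'%:R)^-1 <= `|x - y|.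
Proof.
move=> P0 P'0 /fracsP[p [q [/andP[Pq qQ] _ _ ->]]].
move=> /fracsP[p' [q' [/andP[Pq' qQ'] _ _ ->]]] ne.
have q0 := leq_trans P0 Pq; have q'0 := leq_trans P'0 Pq'.
apply: le_trans (frac_separated q0 q'0 ne).
rewrite lef_pV2 ?posrE ?mulr_gt0 ?ltr0n//; last 2 first.
- exact: leq_trans q0 (ltnW qQ).
- exact: leq_trans q'0 (ltnW qQ').
by rewrite -!natrM ler_nat leq_mul// ltnW.
Qed.

Definition fracs_in (R : realType) (P Q : nat) (a b : R) : seq R :=
  [seq x <- fracs R P Q | a <= x <= b].

Lemma size_fracs_in_le (R : realType) (P Q : nat) (a b : R) :
  (0 < P)%N -> (0 < Q)%N -> a <= b ->
  (size (fracs_in P Q a b))%:R <= 1 + (b - a) * (Q%:R * Q%:R).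
Proof.
move=> P0 Q0 ab; rewrite -[Q%:R * _]invrK.
apply: size_separated => //; rewrite ?invr_gt0 ?mulr_gt0 ?ltr0n//.
- by rewrite filter_uniq// fracs_uniq.
- by move=> x; rewrite mem_filter => /andP[].
- move=> x y; rewrite !mem_filter => /andP[_ xs] /andP[_ ys].
  exact: fracs_separated xs ys.
Qed.

(** With [J] the length of an interval, the [m]-th term is, up to a common factor, a bound for the
    pairs whose reduced denominator lies in the [m]-th dyadic block: at most [1 + J * 4^m] values,
    each with a number of gcds proportional to [2^(-m)]. *)
Lemma sum_dyadic_le (R : realType) (J : R) (M : nat) : 0 <= J -> (0 < M)%N ->
  \sum_(1 <= m < M) (1 + J * 4 ^+ m) / 2 ^+ m <= 1 + J * 2 ^+ M.
Proof.
move=> J0; case: M => // M _.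
have -> : \sum_(1 <= m < M.+1) (1 + J * 4 ^+ m) / 2 ^+ m =
    1 - (2 ^+ M)^-1 + J * (2 ^+ M.+1 - 2) :> R.
  elim: M => [|M IH].
    by rewrite big_geq// expr0 expr1 invr1; ring.
  rewrite big_nat_recr//= IH.
  have -> : (4 : R) = 2 * 2 by ring.
  rewrite exprMn !exprS; field.
  by rewrite expf_neq0.
have : 0 <= (2 ^+ M : R)^-1 by rewrite invr_ge0 exprn_ge0.
by move: ((2 ^+ M)^-1) (2 ^+ M.+1) => u v u0; nra.
Qed.

(** Pairs need not be coprime, so each [q] contributes a plain difference of integer parts; reduced
    fractions are then counted by subtraction, without any estimate of the totient function. *)
Definition frac_pairs (R : realType) (P Q : nat) (a b : R) : seq (nat * nat) :=
  [seq (p, q) | q <- index_iota P Q,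
     p <- iota (Num.truncn (a * q%:R)).+1
               (Num.truncn (b * q%:R) - Num.truncn (a * q%:R))].

Lemma frac_pairsP (R : realType) (P Q : nat) (a b : R) (p q : nat) :
  0 <= a -> a <= b -> (p, q) \in frac_pairs P Q a b ->
  (P <= q < Q)%N /\ a * q%:R <= p%:R <= b * q%:R.
Proof.
move=> a0 ab /allpairsPdep[q' [p' [qPQ]]].
rewrite mem_iota => /andP[ap pb] [-> ->]; split; first by rewrite mem_index_iota in qPQ.
have aq : 0 <= a * q'%:R by rewrite mulr_ge0.
have bq : 0 <= b * q'%:R by rewrite mulr_ge0// (le_trans a0).
apply/andP; split.
  by rewrite ltW// -truncn_lt_nat.
rewrite -truncn_ge_nat// -ltnS (leq_trans pb)// addSn subnKC//.
by apply: le_truncn; rewrite ler_wpM2r.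
Qed.

Lemma frac_pairs_uniq (R : realType) (P Q : nat) (a b : R) :
  uniq (frac_pairs P Q a b).
Proof.
apply: allpairs_uniq_dep => [|q _|]; rewrite ?iota_uniq//.
by move=> [q p] [q' p'] _ _ [-> ->].
Qed.

Lemma size_frac_pairs (R : realType) (P Q : nat) (a b : R) :
  0 <= a -> a <= b -> (P <= Q)%N ->
  (Q - P)%:R * ((b - a) * P%:R - 1) <= (size (frac_pairs P Q a b))%:R.
Proof.
move=> a0 ab PQ; rewrite size_allpairs_dep sumnE big_map natr_sum.
rewrite mulr_natl -sumr_const_nat big_seq [leRHS]big_seq.
apply: ler_sum => q; rewrite mem_index_iota size_iota => /andP[Pq _].
have aq : 0 <= a * q%:R by rewrite mulr_ge0.
have bq : 0 <= b * q%:R by rewrite mulr_ge0// (le_trans a0).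
rewrite natrB; last by apply: le_truncn; rewrite ler_wpM2r.
have := truncnS_gt (b * q%:R); have : (Num.truncn (a * q%:R))%:R <= a * q%:R.
  by rewrite truncn_le.
rewrite -natr1.
have : (b - a) * P%:R <= (b - a) * q%:R by rewrite ler_wpM2l ?subr_ge0 ?ler_nat.
lra.
Qed.

(* A pair (p, q) is determined by the value p / q and by gcd (p, q), and the gcd
   is at most q / d when the reduced denominator is at least d. *)
Lemma size_frac_pairs_le (R : realType) (N : nat) (a b : R) :
  0 <= a -> a <= b -> b <= 1 -> (5 <= N)%N ->
  (size (frac_pairs (2 ^ N.-1) (2 ^ N) a b) <=
   \sum_(1 <= m < N - 4) size (fracs_in (2 ^ m.-1) (2 ^ m) a b) * 2 ^ (N - m).+1 +
   size (fracs_in (2 ^ (N - 5)) (2 ^ N) a b) * 32)%N.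
Proof.
move=> a0 ab b1 N5.
pose f (z : nat * nat) := (z.1%:R / z.2%:R : R, gcdn z.1 z.2).
set P := frac_pairs _ _ _ _.
have Pq z : z \in P -> (0 < z.2)%N.
  case: z => p q /(frac_pairsP a0 ab)[/andP[+ _] _] /=.
  by apply: leq_trans; rewrite expn_gt0.
have red (p q : nat) : (0 < q)%N ->
    p%:R / q%:R = (p %/ gcdn p q)%:R / (q %/ gcdn p q)%:R :> R.
  move=> q0; have g0 : (0 < gcdn p q)%N by rewrite gcdn_gt0 q0 orbT.
  have e1 : (p%:R : R) = (p %/ gcdn p q)%:R * (gcdn p q)%:R.
    by rewrite -natrM divnK// dvdn_gcdl.
  have e2 : (q%:R : R) = (q %/ gcdn p q)%:R * (gcdn p q)%:R.
    by rewrite -natrM divnK// dvdn_gcdr.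
  rewrite {1}e1 {1}e2 -mulf_div divff ?mulr1// pnatr_eq0 -lt0n//.
have cop (p q : nat) : (0 < q)%N -> coprime (p %/ gcdn p q) (q %/ gcdn p q).
  move=> q0; have g0 : (0 < gcdn p q)%N by rewrite gcdn_gt0 q0 orbT.
  rewrite /coprime -(eqn_pmul2r g0) mul1n muln_gcdl !divnK ?dvdn_gcdl ?dvdn_gcdr//.
have qd0 (p q : nat) : (0 < q)%N -> (0 < q %/ gcdn p q)%N.
  move=> q0; have g0 : (0 < gcdn p q)%N by rewrite gcdn_gt0 q0 orbT.
  by rewrite divn_gt0// dvdn_leq// dvdn_gcdr.
have finj : {in P &, injective f}.
  move=> [p q] [p' q'] /Pq /= q0 /Pq /= q'0 [e g].
  move: e; rewrite (red _ _ q0) (red _ _ q'0) => e.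
  have [e1 e2] := coprime_frac_inj (qd0 p q q0) (qd0 p' q' q'0)
     (cop _ _ q0) (cop _ _ q'0) e.
  congr pair.
    by rewrite -(divnK (dvdn_gcdl p q)) -(divnK (dvdn_gcdl p' q')) e1 g.
  by rewrite -(divnK (dvdn_gcdr p q)) -(divnK (dvdn_gcdr p' q')) e2 g.
(* Write [q = d * g] with [g] the gcd and [q < 2^N]: from [2^(m-1) <= d] follows [g < 2^(N-m+1)],
   and from [2^(N-5) <= d] follows [g < 32]. *)
pose T := flatten [seq [seq (x, g) | x <- fracs_in (2 ^ m.-1) (2 ^ m) a b,
                                      g <- iota 0 (2 ^ (N - m).+1)]
                       | m <- index_iota 1 (N - 4)] ++
  [seq (x, g) | x <- fracs_in (2 ^ (N - 5)) (2 ^ N) a b, g <- iota 0 32].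
have -> : (\sum_(1 <= m < N - 4) size (fracs_in (2 ^ m.-1) (2 ^ m) a b) * 2 ^ (N - m).+1 +
   size (fracs_in (2 ^ (N - 5)) (2 ^ N) a b) * 32)%N = size T.
  rewrite size_cat size_flatten sumnE !big_map size_allpairs size_iota.
  by congr addn; apply: eq_bigr => m _; rewrite size_allpairs size_iota.
rewrite -(size_map f); apply: uniq_leq_size.
  by rewrite map_inj_in_uniq// frac_pairs_uniq.
move=> _ /mapP[[p q] zP ->].
have [/andP[Nq qN] /andP[aq qb]] := frac_pairsP a0 ab zP.
have q0 : (0 < q)%N := Pq _ zP.
have q0R : 0 < q%:R :> R by rewrite ltr0n.
have g0 : (0 < gcdn p q)%N by rewrite gcdn_gt0 q0 orbT.
set d := (q %/ gcdn p q)%N.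
have d0 : (0 < d)%N := qd0 p q q0.
have qE : q = (d * gcdn p q)%N by rewrite divnK// dvdn_gcdr.
have dq : (d <= q)%N by rewrite leq_div.
have pq : (p <= q)%N.
  by rewrite -(ler_nat R) (le_trans qb)// ler_piMl.
have xab : a <= p%:R / q%:R <= b by rewrite ler_pdivlMr// ler_pdivrMr// aq.
have mem_f P' Q' : (P' <= d < Q')%N -> p%:R / q%:R \in fracs_in P' Q' a b.
  move=> PQ'; rewrite mem_filter xab; apply/fracsP.
  exists (p %/ gcdn p q)%N, d; split=> //; last exact: red.
    by apply: leq_div2r.
  exact: cop.
rewrite mem_cat; have [Nd|dN] := leqP (2 ^ (N - 5)) d.
  apply/orP; right. apply/allpairsP.
  exists (p%:R / q%:R, gcdn p q); split=> //.
    by apply: mem_f; rewrite Nd (leq_ltn_trans dq).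
  rewrite -[(_, _).2]/(gcdn p q) mem_iota add0n leq0n andTb -(ltn_pmul2l d0) -qE (leq_trans qN)//.
  by rewrite -{1}(subnK N5) expnD leq_mul2r Nd orbT.
apply/orP; left; apply/flattenP.
pose m := (trunc_log 2 d).+1.
have /andP[md dm] : (2 ^ m.-1 <= d < 2 ^ m)%N by apply: trunc_log_bounds.
exists [seq (x, g) | x <- fracs_in (2 ^ m.-1) (2 ^ m) a b,
                     g <- iota 0 (2 ^ (N - m).+1)].
  apply/mapP; exists m => //; rewrite mem_index_iota /=.
  have := leq_ltn_trans md dN; rewrite ltn_exp2l//=; lia.
apply/allpairsP; exists (p%:R / q%:R, gcdn p q); split=> //.
  by apply: mem_f; rewrite md dm.
rewrite -[(_, _).2]/(gcdn p q) mem_iota add0n leq0n andTb -(ltn_pmul2l d0) -qE (leq_trans qN)//.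
apply: (@leq_trans (2 ^ m.-1 * 2 ^ (N - m).+1)); last by rewrite leq_mul2r md orbT.
by rewrite -expnD leq_exp2l// /m /=; lia.
Qed.

(** With [Q = 32^n] and [J = b - a], there are at least [J Q^2 / 4 - Q / 2] pairs with
    [Q / 2 <= q < Q]. At most [2 Q + J Q^2 / 8] of them have reduced denominator below [Q / 32], and
    each remaining value occurs at most 32 times. With 16 in place of 32 the same estimate would
    subtract [J Q^2 / 4], the whole main term; hence the base 32. *)
Lemma fracs_count (R : realType) (a b : R) : 0 <= a -> a < b -> b <= 1 ->
  exists n0, forall n, (n0 <= n)%N ->
    (b - a) / 512 * 1024 ^+ n <= (size (fracs_in (32 ^ n.-1) (32 ^ n) a b))%:R.
Proof.
move=> a0 ab b1; set J := b - a.
have J0 : 0 < J by rewrite subr_gt0.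
(* From [40 <= J Q] the linear terms [5 Q / 2] are at most [J Q^2 / 16], so [J Q^2 / 16] pairs are
   left, and division by 32 gives the constant 512. *)
exists (Num.truncn (40 / J)).+1 => -[//|n] nn0.
have Q40 : 40 <= J * 32 ^+ n.+1.
  rewrite mulrC -ler_pdivrMr// (le_trans (ltW (truncnS_gt _)))//.
  by rewrite -natrX ler_nat (leq_trans nn0)// ltnW// ltn_expl.
pose N := (5 * n.+1)%N.
have N5 : (5 <= N)%N by rewrite /N mulnS leq_addr.
have QE : (32 ^ n.+1 = 2 ^ N)%N by rewrite /N expnM.
have PE : (32 ^ n = 2 ^ (N - 5))%N by rewrite /N mulnS addnC addnK expnM.
rewrite -[n.+1.-1]/n QE PE.
set f := (size _)%:R.
have h1 := size_frac_pairs a0 (ltW ab) (leq_pexp2l (isT : 0 < 2)%N (leq_pred N)).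
have h2 := size_frac_pairs_le a0 (ltW ab) b1 N5.
move: h2; rewrite -(ler_nat R) natrD natrM -/f natr_sum => /(le_trans h1).
set Q : R := (32 ^+ n.+1) in Q40 *.
have QN : (2 ^+ N : R) = Q by rewrite -natrX -QE natrX.
have QN1 : (2 ^+ N.-1 : R) = Q / 2.
  by rewrite -QN -[in RHS](prednK (leq_trans _ N5))// exprS; field.
have -> : (1024 ^+ n.+1 : R) = Q * Q.
  by rewrite /Q -exprMn; congr (_ ^+ _); ring.
have Q0 : 0 < Q by rewrite exprn_gt0.
rewrite natrB ?leq_pexp2l ?leq_pred// !natrX QN QN1 -/J.
have S : \sum_(1 <= m < N - 4)
   (size (fracs_in (2 ^ m.-1) (2 ^ m) a b) * 2 ^ (N - m).+1)%:R <= 2 * Q + J * Q ^+ 2 / 8.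
  apply: (@le_trans _ _ (2 * Q * \sum_(1 <= m < N - 4) (1 + J * 4 ^+ m) / 2 ^+ m)).
    rewrite mulr_sumr big_seq [leRHS]big_seq; apply: ler_sum => m.
    rewrite mem_index_iota => /andP[m1 mN]; rewrite natrM.
    have -> : 2 * Q * ((1 + J * 4 ^+ m) / 2 ^+ m) = (1 + J * 4 ^+ m) * (2 ^ (N - m).+1)%:R.
      rewrite natrX exprS -QN -{1}(subnK (_ : m <= N)%N); last by lia.
      by rewrite exprD; field; rewrite expf_neq0.
    rewrite ler_wpM2r//.
    apply: le_trans (size_fracs_in_le _ _ (ltW ab)) _; rewrite ?expn_gt0//.
    by rewrite natrX -exprMn -/J (_ : 2 * 2 = 4 :> R)//; ring.
  have := @sum_dyadic_le R J (N - 4) (ltW J0); rewrite subn_gt0 => /(_ N5) h.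
  apply: le_trans (ler_wpM2l _ h) _; first by rewrite mulr_ge0// ltW.
  have -> : (2 ^+ (N - 4) : R) = Q / 16.
    rewrite -QN -{2}(subnK (ltnW N5)) exprD.
    have -> : (2 ^+ 4 : R) = 16 by ring.
    by field.
  by rewrite le_eqVlt; apply/orP; left; apply/eqP; field.
move: S; set S := \sum_(_ <= _ < _) _ => S1 S2.
have : 40 * Q <= J * Q * Q by rewrite ler_pM2r.
move: S1 S2.
have -> : (Q - Q / 2) * (J * (Q / 2) - 1) = J * Q * Q / 4 - Q / 2 by field.
have -> : J / 512 * (Q * Q) = J * Q * Q / 512 by ring.
rewrite expr2 mulrA; move: (J * Q * Q) => u; lra.
Qed.

Lemma count_has_le (T I : Type) (P : I -> pred T) (s : seq I) (t : seq T) :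
  (count (fun x => has (P^~ x) s) t <= \sum_(i <- s) count (P i) t)%N.
Proof.
elim: s => [|i s IH]; first by rewrite big_nil /= count_pred0.
rewrite big_cons /= (leq_trans _ (leq_add (leqnn _) IH))//.
by rewrite -count_predUI leq_addr.
Qed.

Lemma sum_nat_widen (R : realType) (P : pred nat) (F : nat -> R) (m n n' : nat) :
  (forall i, 0 <= F i) -> (n <= n')%N ->
  \sum_(m <= i < n | P i) F i <= \sum_(m <= i < n' | P i) F i.
Proof.
move=> F0 nn'; have [mn|nm] := leqP m n; last first.
  by rewrite big_geq ?(ltnW nm)// sumr_ge0.
by rewrite [leRHS](big_cat_nat mn nn')//= lerDl sumr_ge0.
Qed.

Lemma seq_common_bound (T : eqType) (s : seq T) (P : T -> nat -> Prop) :
  (forall x n n', (n <= n')%N -> P x n -> P x n') ->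
  {in s, forall x, exists n, P x n} -> exists n, {in s, forall x, P x n}.
Proof.
move=> mono; elim: s => [|x s IH] h; first by exists 0%N.
have [n hn] := h x (mem_head _ _).
have [y ys|n' hn'] := IH; first by apply: h; rewrite inE ys orbT.
exists (maxn n n') => y; rewrite inE => /orP[/eqP->|ys].
  exact: mono (leq_maxl _ _) hn.
exact: mono (leq_maxr _ _) (hn' _ ys).
Qed.

(** * Levels of fractions and their sparse subfamilies *)

Lemma base_gt0 (R : realType) (n : nat) : 0 < 1024 ^+ n :> R.
Proof. by apply: exprn_gt0; rewrite ltr0n. Qed.

Lemma base_ge1 (R : realType) (n : nat) : 1 <= 1024 ^+ n :> R.
Proof. by apply: exprn_ege1; rewrite ler1n. Qed.

(** Reduced denominators in [[32^(n-1), 32^n[], so that points of level [n] are [1024^(-n)] apart.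
    Level 0 is empty because [0.-1 = 0]. *)
Definition level (R : realType) (n : nat) : seq R := fracs R (32 ^ n.-1) (32 ^ n).

Lemma level_separated (R : realType) (n m : nat) (x y : R) :
  (n <= m)%N -> x \in level R n -> y \in level R m -> x != y ->
  (1024 ^+ m)^-1 <= `|x - y|.
Proof.
move=> nm xn ym xy.
have e (k : nat) : (0 < 32 ^ k)%N by rewrite expn_gt0.
apply: le_trans (fracs_separated (e _) (e _) xn ym xy).
have e1 := base_gt0 R m.
have e2 k : 0 < (32 ^ k)%:R :> R by rewrite ltr0n.
have e3 : 1024 ^+ m = (32 ^ m)%:R * (32 ^ m)%:R :> R.
  by rewrite natrX -exprMn (_ : 32%:R * 32%:R = 1024 :> R)//; ring.
rewrite lef_pV2 ?posrE; [|exact: e1|exact: mulr_gt0].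
by rewrite e3 ler_pM2r// ler_nat leq_exp2l.
Qed.

Lemma level_inj (R : realType) (n m : nat) (x : R) :
  x \in level R n -> x \in level R m -> n = m.
Proof.
move=> /fracsP[p [q [/andP[nq qn] _ cpq ->]]] /fracsP[p' [q' [/andP[nq' qn'] _ cpq' e]]].
have e0 (k : nat) : (0 < 32 ^ k)%N by rewrite expn_gt0.
have [_ qq'] := coprime_frac_inj (leq_trans (e0 _) nq) (leq_trans (e0 _) nq') cpq cpq' e.
rewrite -qq' in nq' qn'.
have := leq_ltn_trans nq qn'; have := leq_ltn_trans nq' qn; rewrite !ltn_exp2l//.
case: n nq qn => [|n] nq qn; first by move: nq qn; rewrite expn0; lia.
case: m nq' qn' => [|m] nq' qn'; first by move: nq' qn'; rewrite expn0; lia.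
by rewrite /=; lia.
Qed.

Section sparse.
Variables (R : realType) (r : nat -> R).
Hypothesis r_gt0 : forall n, 0 < r n.
Hypothesis r_small : forall e, 0 < e -> exists L0, forall L L', (L0 <= L)%N ->
  \sum_(L <= m < L') 1024 ^+ m * r m <= e.

(* The points of level n too close to a point of a level in [L, n[ are dropped, so that
   a ball smaller than two of the remaining balls touches at most one of them. *)
Definition sparse (L n : nat) (a b : R) : seq R :=
  [seq x <- fracs_in (32 ^ n.-1) (32 ^ n) a b |
    ~~ has (fun z => `|x - z.2| <= 4 * r z.1)
       [seq (m, y) | m <- index_iota L n, y <- level R m]].

Lemma size_level_le n : (size (level R n))%:R <= 2 * 1024 ^+ n :> R.
Proof.
have -> : level R n = fracs_in (32 ^ n.-1) (32 ^ n) 0 1.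
  symmetry; apply/all_filterP/allP => x /fracsP[p [q [/andP[nq _] pq _ ->]]].
  have q0 : (0 < q)%N by apply: leq_trans nq; rewrite expn_gt0.
  by rewrite divr_ge0//= ler_pdivrMr ?ltr0n// mul1r ler_nat.
apply: le_trans (size_fracs_in_le _ _ ler01) _; rewrite ?expn_gt0//.
rewrite subr0 mul1r natrX -exprMn (_ : 32 * 32 = 1024 :> R); last by ring.
have := base_ge1 R n.
lra.
Qed.

Lemma level_near_le (n m : nat) (y : R) : (m < n)%N -> y \in level R m ->
  (count (fun x => `|x - y| <= 4 * r m) (level R n))%:R <= 8 * r m * 1024 ^+ n :> R.
Proof.
move=> mn ym; rewrite -size_filter.
set s := [seq x <- level R n | `|x - y| <= 4 * r m].
have sl : {subset s <= level R n} by move=> x; rewrite mem_filter => /andP[].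
have -> : 8 * r m * 1024 ^+ n = 2 * (4 * r m) / (1024 ^+ n)^-1.
  by rewrite invrK; ring.
apply: (@size_separated_around _ _ y).
- by rewrite invr_gt0; exact: base_gt0.
- by rewrite mulr_ge0// ltW.
- by rewrite filter_uniq// fracs_uniq.
- by apply/negP => /sl yn; move: mn; rewrite (level_inj ym yn) ltnn.
- by move=> x; rewrite mem_filter => /andP[].
- move=> x z; rewrite !inE => /orP[/eqP->|xs] /orP[/eqP->|zs]; rewrite ?eqxx// => ne.
  + exact: level_separated (ltnW mn) ym (sl _ zs) ne.
  + rewrite distrC; apply: level_separated (ltnW mn) ym (sl _ xs) _.
    by rewrite eq_sym.
  + exact: level_separated (leqnn _) (sl _ xs) (sl _ zs) ne.
Qed.

(** A point of level [m < n] excludes at most [8 r_m 1024^n] points of level [n], and level [m] has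
    at most [2 * 1024^m] points. So at most [16 * 1024^n] times the tail of the series of
    [1024^m r_m] is lost; the tail is taken small enough (the factor 32) for this to be half of the
    count in [fracs_count]. *)
Lemma size_sparse_ge (a b : R) : 0 <= a -> a < b -> b <= 1 ->
  exists L0, forall L n, (L0 <= L)%N -> (L <= n)%N ->
    (b - a) / 512 / 2 * 1024 ^+ n <= (size (sparse L n a b))%:R.
Proof.
move=> a0 ab b1; have [n0 hn0] := fracs_count a0 ab b1.
have ba : 0 < b - a by rewrite subr_gt0.
have e0 : 0 < (b - a) / 512 / 32 by apply: divr_gt0; [apply: divr_gt0|]; rewrite ?ltr0n.
have [L1 hL1] := r_small e0.
exists (maxn n0 L1) => L n; move: ((b - a) / 512) hn0 hL1 => D hn0 hL1; rewrite geq_max => /andP[n0L L1L] Ln.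
have := hn0 n (leq_trans n0L Ln).
pose bad (z : nat * R) (x : R) := `|x - z.2| <= 4 * r z.1.
pose Y := [seq (m, y) | m <- index_iota L n, y <- level R m].
have := count_predC (fun x => has (bad^~ x) Y) (fracs_in (32 ^ n.-1) (32 ^ n) a b).
rewrite -[count (predC _) _]size_filter -/(sparse L n a b) => <-.
rewrite natrD => h.
have : (count (fun x => has (bad^~ x) Y) (fracs_in (32 ^ n.-1) (32 ^ n) a b))%:R
   <= D / 2 * 1024 ^+ n.
  apply: (@le_trans _ _ (\sum_(z <- Y) 8 * r z.1 * 1024 ^+ n)).
    apply: (@le_trans _ _ (\sum_(z <- Y) (count (bad z) (level R n))%:R)).
      rewrite -natr_sum ler_nat; apply: leq_trans (count_has_le _ _ _) _.
      apply: leq_sum => z _; rewrite count_filter; apply: sub_count => x /=.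
      by case/andP.
    rewrite big_seq [leRHS]big_seq; apply: ler_sum => -[m y].
    rewrite -[(m, y).1]/m; move=> /allpairsPdep[m' [y' [mL ym [-> ->]]]].
    move: mL; rewrite mem_index_iota => /andP[_ mn].
    exact: level_near_le.
  rewrite big_allpairs_dep/=.
  apply: (@le_trans _ _ (16 * 1024 ^+ n * \sum_(L <= m < n) 1024 ^+ m * r m)).
    rewrite mulr_sumr; apply: ler_sum => m _.
    rewrite big_const_seq count_predT iter_addr_0 -[leLHS]mulr_natr.
    have -> : 16 * 1024 ^+ n * (1024 ^+ m * r m) =
      8 * r m * 1024 ^+ n * (2 * 1024 ^+ m) by ring.
    apply: ler_wpM2l (size_level_le _); apply: mulr_ge0 (ltW (base_gt0 _ _)).
    by apply: mulr_ge0 (ltW (r_gt0 _)).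
  have -> : D / 2 * 1024 ^+ n = 16 * 1024 ^+ n * (D / 32) by field.
  by apply: ler_wpM2l (hL1 _ _ L1L); apply: mulr_ge0 (ltW (base_gt0 _ _)).
by move: h; move: (1024 ^+ n) => B; lra.
Qed.

Lemma sparse_level L n a b x : x \in sparse L n a b -> x \in level R n /\ a <= x <= b.
Proof. by rewrite !mem_filter => /and3P[_ ? ?]. Qed.

(** On one level this is the spacing [1024^(-n)], across levels it is the defining exclusion. The
    factor 4 is what a cover element needs: if its radius is below both [r n] and [r m] and it
    touches both balls, the centres are within 4 times the larger radius, which is [r (minn n m)]
    for nonincreasing [r]. *)
Lemma sparse_far (L n m : nat) (a b : R) (x y : R) :
  (L <= n)%N -> (L <= m)%N -> (forall k, (L <= k)%N -> 4 * r k < (1024 ^+ k)^-1) ->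
  x \in sparse L n a b -> y \in sparse L m a b -> (n, x) != (m, y) ->
  4 * r (minn n m) < `|x - y|.
Proof.
move=> Ln Lm rL; wlog nm : n m x y Ln Lm / (n <= m)%N => [H xn ym ne|].
  have /orP[nm|mn] := leq_total n m; first exact: H.
  by rewrite minnC distrC; apply: H; rewrite // eq_sym.
move=> xn ym ne; rewrite (minn_idPl nm).
have [xl _] := sparse_level xn; have [yl _] := sparse_level ym.
move: nm ne; rewrite leq_eqVlt => /orP[/eqP nm|nm _].
  rewrite -nm in yl *; rewrite xpair_eqE eqxx /= => ne.
  exact: lt_le_trans (rL _ Ln) (level_separated (leqnn _) xl yl ne).
move: ym; rewrite mem_filter => /andP[/hasPn/(_ (n, x)) + _] => /(_ _)/=.
rewrite -ltNge distrC; apply; apply/allpairsPdep; exists n, x; split => //.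
by rewrite mem_index_iota Ln nm.
Qed.

End sparse.

(** * Nested balls avoiding a cover *)

Section step.
Variables (R : realType) (r : nat -> R) (g : R -> R) (delta : R).
Hypothesis r_gt0 : forall n, 0 < r n.
Hypothesis r_noninc : forall n m, (n <= m)%N -> r m <= r n.
Hypothesis r_small : forall e, 0 < e -> exists L0, forall L L', (L0 <= L)%N ->
  \sum_(L <= m < L') 1024 ^+ m * r m <= e.
Hypothesis g_ge0 : forall x, 0 <= g x.
Hypothesis g_tail : forall x L L', 0 < x -> x <= delta ->
  \sum_(L <= n < L' | r n <= x) g (r n) <= 2 * g x.
Hypothesis g_div : forall L M, exists L', M <= \sum_(L <= n < L') 1024 ^+ n * g (r n).
Variables c rho : nat -> R.
Hypothesis rho_itv : forall i, 0 < rho i <= delta.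

Definition touch (i : nat) (x s : R) := `|c i - x| <= rho i + s.

Lemma touch_sub i x s y t : touch i x s -> `|x - y| + s <= t -> touch i y t.
Proof.
rewrite /touch => h1 h2; have -> : c i - y = (c i - x) + (x - y) by ring.
by apply: le_trans (ler_normD _ _) _; lra.
Qed.

Lemma r_eventually_small e : 0 < e ->
  exists L0, forall n, (L0 <= n)%N -> 1024 ^+ n * r n <= e.
Proof.
move=> e0; have [L0 h] := r_small e0; exists L0 => n Ln.
by have := h n n.+1 Ln; rewrite big_nat1.
Qed.

(** At a level with [r n <= rho i], the touched points lie in an interval of length [4 * rho i], so
    there are at most [1 + 4 * rho i * 1024^n] of them. The terms 1 add up by [g_tail] to the weight
    of the element, the others to a share of the whole sum proportional to its length. *)
Lemma killed_weight_le (i L L' : nat) (a b : R) :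
  \sum_(L <= n < L' | r n <= rho i)
    \sum_(x <- sparse r L n a b | touch i x (r n)) g (r n) <=
  2 * g (rho i) + 4 * rho i * \sum_(L <= n < L') 1024 ^+ n * g (r n).
Proof.
have /andP[ri0 rid] := rho_itv i.
apply: (@le_trans _ _ (\sum_(L <= n < L' | r n <= rho i)
   (g (r n) + 4 * rho i * (1024 ^+ n * g (r n))))).
  apply: ler_sum => n rn.
  rewrite big_const_seq iter_addr_0 -[leLHS]mulr_natl -size_filter.
  have -> : g (r n) + 4 * rho i * (1024 ^+ n * g (r n)) =
     (1 + 4 * rho i * 1024 ^+ n) * g (r n) by ring.
  apply: ler_wpM2r => //.
  have -> : 1 + 4 * rho i * 1024 ^+ n =
      1 + ((c i + 2 * rho i) - (c i - 2 * rho i)) / (1024 ^+ n)^-1.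
    by rewrite invrK; ring.
  apply: size_separated.
  - by rewrite invr_gt0; exact: base_gt0.
  - by lra.
  - by rewrite !filter_uniq// fracs_uniq.
  - move=> x; rewrite mem_filter => /andP[]; rewrite /touch ler_norml => /andP[? ?] _.
    by apply/andP; split; lra.
  - move=> x y; rewrite !mem_filter => /and4P[_ _ _ xl] /and4P[_ _ _ yl].
    exact: level_separated (leqnn _) xl yl.
rewrite big_split/=; apply: lerD; first exact: g_tail.
rewrite -mulr_sumr; apply: ler_wpM2l; first by rewrite mulr_ge0// ltW.
rewrite [leRHS](bigID (fun n => r n <= rho i))/= lerDl.
by apply: sumr_ge0 => n _; apply: mulr_ge0 (ltW (base_gt0 _ _)) (g_ge0 _).
Qed.

(* Otherwise every ball around a sparse point of a level in [L, L'[ carries too much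
   weight. The total weight of these balls exceeds a multiple of R0 * K. Those touched
   by a larger element of the cover account for at most 2 * S + 4 * theta * R0 * K by
   killed_weight_le, and the others for S / theta, because an element of the cover
   smaller than the balls touches at most one of them. Let K tend to infinity. *)
Lemma child_exists (x0 R0 S theta : R) (n1 : nat) :
  0 < R0 -> 0 <= x0 - R0 -> x0 + R0 <= 1 -> 0 < theta ->
  64 * (256 * theta) <= 1 ->
  (forall N, \sum_(0 <= i < N | touch i x0 R0) g (rho i) <= S) ->
  (forall N, \sum_(0 <= i < N | touch i x0 R0) rho i <= theta * R0) ->
  exists n x, [/\ (n1 <= n)%N, x \in level R n, `|x - x0| + r n <= R0 &
    forall N, \sum_(0 <= i < N | touch i x (r n)) g (rho i) <= theta * g (r n)].
Proof.
move=> R00 x0a x0b theta0 theta_small gS rS.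
(* Centres in the half ball and radii at most [R0 / 2] keep the children inside the ball. The bound
   [1 / 8] below yields [4 * r k < 1024^(-k)], as [sparse_far] requires. *)
pose a := x0 - R0 / 2; pose b := x0 + R0 / 2.
have ab : b - a = R0 by rewrite /a /b; field.
have [|||L0 hL0] := @size_sparse_ge R r r_gt0 r_small a b; rewrite /a /b; try lra.
have e0 : 0 < Num.min (R0 / 2) (1 / 8) by rewrite lt_min; apply/andP; split; lra.
have [L1 hL1] := r_eventually_small e0.
pose L := maxn n1 (maxn L0 L1).
have [n1L L0L L1L] : [/\ (n1 <= L)%N, (L0 <= L)%N & (L1 <= L)%N].
  by rewrite /L !leq_max !leqnn !orbT.
have rL k : (L <= k)%N -> r k <= R0 / 2 /\ 4 * r k < (1024 ^+ k)^-1.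
  move=> Lk; have := hL1 k (leq_trans L1L Lk); rewrite le_min => /andP[h2 h8]; split.
    by apply: le_trans h2; rewrite ler_peMl ?base_ge1// ltW.
  rewrite -[_^-1]mul1r ltr_pdivlMr; [|exact: base_gt0].
  by rewrite -mulrA [r k * _]mulrC; move: (_ * r k) h8 => z h8; lra.
have S0 : 0 <= S by have := gS 0%N; rewrite big_geq.
(* The contradiction comes from [R0 K / 1024 <= 2 S + 4 theta R0 K + S / theta], where
   [1024 = 512 * 2] stems from [size_sparse_ge]. By [theta_small], [4 * theta] is at most
   [1 / 4096], and this [L'] makes [2 S + S / theta + 1] at most [R0 K / 4096]. *)
have [L' hL'] := g_div L ((2 * S + S / theta + 1) * (64 * 64) / R0).
move: hL'; set K := \sum_(_ <= _ < _) _ => hK.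
have K0 : 0 <= K.
  by apply: sumr_ge0 => n _; apply: mulr_ge0 (ltW (base_gt0 _ _)) (g_ge0 _).
apply: contrapT => none.
pose Z := [seq (n, x) | n <- index_iota L L', x <- sparse r L n a b].
have ZP z : z \in Z -> [/\ (L <= z.1)%N, (z.1 < L')%N & z.2 \in sparse r L z.1 a b].
  move=> /allpairsPdep[n [x [nL xs ->]]] /=.
  by move: nL; rewrite mem_index_iota => /andP[].
have near z : z \in Z -> `|z.2 - x0| + r z.1 <= R0.
  move=> /ZP[Ln _ /sparse_level[_ /andP[az zb]]].
  have [h _] := rL _ Ln.
  have : `|z.2 - x0| <= R0 / 2 by rewrite ler_norml; apply/andP; move: az zb; rewrite /a /b; split; lra.
  by lra.
have [N hN] : exists N, {in Z, forall z,
    theta * g (r z.1) < \sum_(0 <= i < N | touch i z.2 (r z.1)) g (rho i)}.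
  apply: seq_common_bound => [z n n' nn'|z zZ].
    by move=> /lt_le_trans; apply; exact: sum_nat_widen.
  apply: contrapT => h; apply: none; exists z.1, z.2.
  have [Lz _ zs] := ZP _ zZ; split.
  - exact: leq_trans n1L Lz.
  - by have [] := sparse_level zs.
  - exact: near.
  - by move=> N; rewrite leNgt; apply/negP => h'; apply: h; exists N.
pose killed (z : nat * R) := has (fun i => touch i z.2 (r z.1) && (r z.1 <= rho i)) (index_iota 0 N).
have W_ge : R0 / 1024 * K <= \sum_(z <- Z) g (r z.1).
  rewrite big_allpairs_dep/= /K mulr_sumr big_seq [leRHS]big_seq; apply: ler_sum => n.
  rewrite mem_index_iota => /andP[Ln _].
  rewrite big_const_seq count_predT iter_addr_0 -[leRHS]mulr_natl mulrA.
  apply: ler_wpM2r => //; apply: le_trans (hL0 _ _ L0L Ln).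
  rewrite -/a -/b ab; apply: ler_wpM2r; first exact: ltW (base_gt0 _ _).
  by lra.
have W_killed : \sum_(z <- Z | killed z) g (r z.1) <= 2 * S + 4 * theta * R0 * K.
  apply: (@le_trans _ _ (\sum_(z <- Z) \sum_(0 <= i < N | touch i z.2 (r z.1) && (r z.1 <= rho i)) g (r z.1))).
    rewrite big_mkcond; apply: ler_sum => z _; case: ifP => [|_]; last by rewrite sumr_ge0.
    move=> /hasP[i iN Pi]; rewrite (big_rem i iN)/= Pi lerDl sumr_ge0//.
  rewrite big_seq (exchange_big_dep (fun i => touch i x0 R0))/=; last first.
    by move=> z i /near zn /andP[zi _]; exact: touch_sub zi zn.
  apply: (@le_trans _ _ (\sum_(0 <= i < N | touch i x0 R0) (2 * g (rho i) + 4 * rho i * K))).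
    apply: ler_sum => i _; apply: le_trans (killed_weight_le i L L' a b).
    rewrite -big_seq_cond big_mkcond big_allpairs_dep/= [leRHS]big_mkcond/=.
    apply: ler_sum => n _; case: ifP => rn.
      by rewrite [leRHS]big_mkcond/=; apply: ler_sum => x _; rewrite andbT.
    by rewrite big1// => x _; rewrite andbF.
  rewrite big_split/= -mulr_sumr -mulr_suml -mulr_sumr.
  apply: lerD; first by rewrite ler_wpM2l.
  by apply: ler_wpM2r => //; rewrite -[leRHS]mulrA ler_wpM2l.
have W_alive : theta * \sum_(z <- Z | ~~ killed z) g (r z.1) <= S.
  apply: (@le_trans _ _ (\sum_(z <- Z | ~~ killed z)
      \sum_(0 <= i < N | touch i z.2 (r z.1)) g (rho i))).
    rewrite mulr_sumr big_seq_cond [leRHS]big_seq_cond; apply: ler_sum => z /andP[zZ _].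
    exact/ltW/hN.
  rewrite big_seq_cond (exchange_big_dep (fun i => touch i x0 R0))/=; last first.
    by move=> z i /andP[/near zn _] zi; exact: touch_sub zi zn.
  apply: le_trans (gS N); rewrite big_seq_cond [leRHS]big_seq_cond.
  apply: ler_sum => i /andP[iN _].
  rewrite big_const_seq iter_addr_0 -[leLHS]mulr_natl -[leRHS]mul1r -size_filter.
  apply: ler_wpM2r => //; rewrite -[leRHS]/(1%:R) ler_nat.
  set s := [seq z <- Z | _].
  have us : uniq s.
    rewrite filter_uniq//; apply: allpairs_uniq_dep; rewrite ?iota_uniq//.
      by move=> n _; rewrite !filter_uniq// fracs_uniq.
    by move=> [? ?] [? ?] _ _ [-> ->].
  have s_eq z z' : z \in s -> z' \in s -> z = z'.
    rewrite !mem_filter => /andP[/andP[/andP[_ /hasPn/(_ i iN) zk] zi] zZ].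
    move=> /andP[/andP[/andP[_ /hasPn/(_ i iN) zk'] zi'] zZ'].
    apply/eqP/negPn/negP => ne.
    have [Lz _ zs] := ZP _ zZ; have [Lz' _ zs'] := ZP _ zZ'.
    have := sparse_far Lz Lz' (fun k Lk => (rL k Lk).2) zs zs'.
    rewrite -!surjective_pairing => /(_ ne).
    move: zk zk'; rewrite zi zi' /= -!ltNge => h1 h2.
    have := r_noninc (geq_minl z.1 z'.1); have := r_noninc (geq_minr z.1 z'.1).
    move: (minn z.1 z'.1) => m h3 h4; apply/negP; rewrite -leNgt.
    have -> : z.2 - z'.2 = (c i - z'.2) - (c i - z.2) by ring.
    apply: le_trans (ler_normB _ _) _.
    by move: zi zi'; rewrite /touch; lra.
  case: s us s_eq => [|z [|z' s]]// /andP[zs _] s_eq.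
  by move: zs; rewrite (s_eq z z') ?inE ?eqxx ?orbT.
move: W_ge; rewrite (bigID killed)/= => W_ge.
have E0 : 0 <= S / theta by rewrite divr_ge0// ltW.
have A_le : \sum_(z <- Z | ~~ killed z) g (r z.1) <= S / theta.
  by rewrite ler_pdivlMr// mulrC.
have K_ge : 2 * S + S / theta + 1 <= R0 * K / (64 * 64).
  by move: hK; rewrite ler_pdivrMr// [K * R0]mulrC; lra.
have RK0 : 0 <= R0 * K by lra.
have : 64 * (256 * theta) * (R0 * K) <= 1 * (R0 * K) by apply: ler_wpM2r.
have eRK : R0 / 1024 * K = R0 * K / 1024 by field.
have eRK' : 4 * theta * R0 * K = 4 * (theta * (R0 * K)) by ring.
rewrite eRK in W_ge; rewrite eRK' in W_killed.
have -> : 64 * (256 * theta) * (R0 * K) = 64 * (256 * (theta * (R0 * K))) by ring.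
move: (theta * (R0 * K)) W_killed => u W_killed.
move: (R0 * K) K_ge W_ge RK0 => v; lra.
Qed.
End step.

Section nested.
Variables (R : realType) (r : nat -> R) (g : R -> R) (delta : R).
Hypothesis delta_gt0 : 0 < delta.
Hypothesis r_gt0 : forall n, 0 < r n.
Hypothesis r_noninc : forall n m, (n <= m)%N -> r m <= r n.
Hypothesis r_small : forall e, 0 < e -> exists L0, forall L L', (L0 <= L)%N ->
  \sum_(L <= m < L') 1024 ^+ m * r m <= e.
Hypothesis g_ge0 : forall x, 0 <= g x.
Hypothesis g_gt0 : forall x, 0 < x <= delta -> 0 < g x.
Hypothesis g_mono : forall x y, 0 < x -> x <= y -> y <= delta -> g x <= g y.
Hypothesis g_ratio : forall x y, 0 < x -> x <= y -> y <= delta -> x * g y <= y * g x.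
Hypothesis g_tail : forall x L L', 0 < x -> x <= delta ->
  \sum_(L <= n < L' | r n <= x) g (r n) <= 2 * g x.
Hypothesis g_div : forall L M, exists L', M <= \sum_(L <= n < L') 1024 ^+ n * g (r n).
Variables c rho : nat -> R.
Hypothesis rho_itv : forall i, 0 < rho i <= delta.

Lemma nested_limit (u : nat -> R) (v : nat -> R) :
  (forall k, 0 <= v k) -> (forall k, `|u k.+1 - u k| + v k.+1 <= v k) ->
  exists x, forall k, `|x - u k| <= v k.
Proof.
move=> v0 uv.
have lo k j : u k - v k <= u (k + j)%N - v (k + j)%N /\
              u (k + j)%N + v (k + j)%N <= u k + v k.
  elim: j => [|j [IH1 IH2]]; first by rewrite addn0.
  have := uv (k + j)%N; rewrite addnS.
  have := ler_norm (u (k + j).+1 - u (k + j)%N).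
  have := ler_norm (- (u (k + j).+1 - u (k + j)%N)); rewrite normrN.
  by split; lra.
have lohi k j : u k - v k <= u j + v j.
  have [h1 _] := lo k j; have [_ h2] := lo j k; rewrite addnC in h2.
  have := v0 (k + j)%N; lra.
pose E : set R := range (fun k => u k - v k).
exists (sup E) => k; rewrite ler_norml; apply/andP; split.
  have : u k - v k <= sup E.
    apply: ub_le_sup; last by exists k.
    by exists (u 0 + v 0) => _ [j _ <-].
  lra.
have : sup E <= u k + v k.
  by apply: ge_sup => [|_ [j _ <-]//]; exists (u 0 - v 0), 0%N.
lra.
Qed.

(** The induction carries the bound [theta * s] on the lengths of the elements touching the ball of
    radius [s]. [child_exists] returns a bound on weights instead; [g_ratio] converts it, since
    [rho i <= r n] gives [rho i * g (r n) <= r n * g (rho i)]. *)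
Lemma avoiding_point (S theta : R) : 0 < theta -> 64 * (256 * theta) <= 1 ->
  (forall N, \sum_(0 <= i < N) g (rho i) <= S) ->
  (forall N, \sum_(0 <= i < N) rho i <= theta / 2) ->
  exists x, (forall i, rho i < `|c i - x|) /\
    (forall n1, exists n y, [/\ (n1 <= n)%N, y \in level R n & `|x - y| <= r n]).
Proof.
move=> theta0 theta_small gS rS.
have gS' x s N : \sum_(0 <= i < N | touch c rho i x s) g (rho i) <= S.
  apply: le_trans (gS N); rewrite big_mkcond; apply: ler_sum => i _.
  by case: ifP.
have [L0 hL0] := r_eventually_small r_small delta_gt0.
have r_le e : 0 < e -> exists L1, forall n, (L1 <= n)%N -> r n <= e.
  move=> e0; have [L1 hL1] := r_eventually_small r_small e0; exists L1 => n /hL1.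
  by apply: le_trans; rewrite ler_peMl ?base_ge1// ltW.
pose inv (x s : R) := [/\ 0 < s, 0 <= x - s, x + s <= 1 &
  forall N, \sum_(0 <= i < N | touch c rho i x s) rho i <= theta * s].
have theta1 : theta < 1 by lra.
have step x s n1 : inv x s -> exists z : nat * R,
    [/\ (n1 <= z.1)%N, z.2 \in level R z.1, `|z.2 - x| + r z.1 <= s & inv z.2 (r z.1)].
  move=> [s0 xs sx rs].
  have [n [y [nn yn yx hy]]] := child_exists r_gt0 r_noninc r_small g_ge0 g_tail g_div
    rho_itv (maxn n1 L0) s0 xs sx theta0 theta_small (gS' x s) rs.
  move: nn; rewrite geq_max => /andP[n1n L0n].
  have rnd : r n <= delta.
    by apply: le_trans (hL0 _ L0n); rewrite ler_peMl ?base_ge1// ltW.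
  have gr0 : 0 < g (r n) by rewrite g_gt0// r_gt0.
  exists (n, y); split => //; split => //=.
  - by move: yx; rewrite -lerBrDr ler_norml => /andP[? ?]; lra.
  - by move: yx; rewrite -lerBrDr ler_norml => /andP[? ?]; lra.
  - move=> N; rewrite -(ler_pM2r gr0) mulr_suml.
    apply: (@le_trans _ _ (r n * \sum_(0 <= i < N | touch c rho i y (r n)) g (rho i))).
      rewrite mulr_sumr big_seq_cond [leRHS]big_seq_cond; apply: ler_sum => i.
      move=> /andP[iN ti]; have /andP[ri0 rid] := rho_itv i.
      (* An element with [rho i > r n] would alone weigh at least [g (r n)], more than the
         [theta * g (r n)] allowed to all elements touching the child. *)
      apply: g_ratio => //; rewrite leNgt; apply/negP => rni.
      have := hy N; apply/negP; rewrite -ltNge.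
      apply: (@lt_le_trans _ _ (g (r n))); first by rewrite gtr_pMl.
      apply: le_trans (g_mono (r_gt0 n) (ltW rni) rid) _.
      by rewrite (big_rem i iN)/= ti lerDl sumr_ge0.
    rewrite [theta * r n]mulrC -mulrA; apply: ler_wpM2l (hy N).
    exact: ltW.
pose P (kz : nat * (nat * R)) (z' : nat * R) := inv kz.2.2 (r kz.2.1) ->
  [/\ (kz.1 <= z'.1)%N, z'.2 \in level R z'.1,
      `|z'.2 - kz.2.2| + r z'.1 <= r kz.2.1 & inv z'.2 (r z'.1)].
have [f fP] : {f & forall kz, P kz (f kz)}.
  apply: choice => -[k z]; rewrite /P /=.
  have [h|h] := pselect (inv z.2 (r z.1)); last by exists z.
  by have [z' hz'] := step _ _ k h; exists z'.
(* The starting ball is [[0, 1]], of radius 1/2: this is the reason for the bound [theta / 2] on the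
   total length. *)
have [z0 [_ _ _ inv0]] : exists z : nat * R,
    [/\ (0 <= z.1)%N, z.2 \in level R z.1, `|z.2 - 2^-1| + r z.1 <= 2^-1 & inv z.2 (r z.1)].
  apply: step; split; [lra|lra|lra|] => N.
  apply: le_trans (rS N); rewrite big_mkcond; apply: ler_sum => i _.
  by case: ifP => // _; have /andP[/ltW] := rho_itv i.
pose st := fix st k := if k is k'.+1 then f (k', st k') else z0.
have inv_st k : inv (st k).2 (r (st k).1).
  elim: k => [//|k IH] /=; by have [] := fP (k, st k) IH.
have st_step k := fP (k, st k) (inv_st k).
have [x hx] : exists x, forall k, `|x - (st k).2| <= r (st k).1.
  apply: nested_limit => k; first exact: ltW.
  by have [] := st_step k.
exists x; split.
  (* If [x] lay in the ball of index [i], that ball would touch all the nested balls; once their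
     radius is at most [rho i], the invariant would give [rho i <= theta * rho i]. *)
  move=> i; rewrite ltNge; apply/negP => cix.
  have /andP[ri0 _] := rho_itv i.
  have [L1 hL1] := r_le _ ri0.
  have [/= kst _ _ _] := st_step L1.
  have [_ _ _ /(_ i.+1)] := inv_st L1.+1.
  rewrite big_mkcond big_nat_recr//=; case: ifPn => [_|/negP[]]; last first.
    apply: (@touch_sub R c rho i x 0); first by rewrite /touch addr0.
    by rewrite addr0; have := hx L1.+1.
  have := hL1 _ kst; rewrite -/(st L1.+1) => h1; apply/negP; rewrite -ltNge.
  apply: (@lt_le_trans _ _ (rho i)).
    apply: (@lt_le_trans _ _ (r (f (L1, st L1)).1)) => //.
    by rewrite gtr_pMl.
  rewrite lerDr sumr_ge0// => j _; case: ifP => // _.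
  by have /andP[/ltW] := rho_itv j.
move=> n1; have [/= kst yl _ _] := st_step n1.
by exists (st n1.+1).1, (st n1.+1).2; split => //; exact: (hx n1.+1).
Qed.

End nested.

(** * The gauge with exponent -1 *)

Lemma sum_geometric_le (R : realType) (q : R) (m n : nat) : 0 <= q -> q < 1 ->
  \sum_(m <= i < n) q ^+ i <= q ^+ m / (1 - q).
Proof.
move=> q0 q1; have q1' : 0 < 1 - q by rewrite subr_gt0.
have [nm|mn] := leqP n m.
  by rewrite big_geq// divr_ge0 ?exprn_ge0// ltW.
have E k : \sum_(m <= i < m + k) q ^+ i = (q ^+ m - q ^+ (m + k)) / (1 - q).
  elim: k => [|k IH]; first by rewrite addn0 big_geq// subrr mul0r.
  rewrite addnS big_nat_recr ?leq_addr//= IH exprS; field.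
  by rewrite gt_eqF.
by rewrite -(subnKC (ltnW mn)) E ler_pM2r ?invr_gt0// gerBl exprn_ge0.
Qed.

Lemma expr_small (R : realType) (q e : R) : 0 <= q -> q < 1 -> 0 < e ->
  exists n0, forall n, (n0 <= n)%N -> q ^+ n <= e.
Proof.
move=> q0 q1 e0.
have /cvgrPdist_le /(_ _ e0)[n0 _ h] : q ^+ n @[n --> \oo] --> (0 : R).
  by apply: cvg_expr; rewrite ger0_norm.
exists n0 => n nn; have := h n nn; rewrite sub0r normrN ger0_norm ?exprn_ge0//.
Qed.

Section gauge.
Variables (R : realType) (tau : R).
Hypothesis tau_gt2 : 2 < tau.
Let g := log_gauge tau (-1).
Let a := 2 / tau.
Let b := 1 - a.

Let tau0 : 0 < tau. Proof. exact: lt_trans tau_gt2. Qed.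
Let a0 : 0 < a. Proof. by rewrite divr_gt0. Qed.
Let b0 : 0 < b. Proof. by rewrite subr_gt0 ltr_pdivrMr// mul1r. Qed.

(** The substitution [x = exp (- u)] removes the logarithm; the estimates of the gauge below are
    carried out in the variable [u]. *)
Lemma gauge_expR (u : R) : 0 <= u -> g (expR (- u)) = expR (- (a * u)) / u.
Proof.
move=> u0; rewrite /g /log_gauge div1r -expRN opprK expRK -expRM -/a mulNr.
rewrite [u * a]mulrC; congr (_ * _).
(* At [u = 0] the identity rests on default values: the power -1 of 0 and the inverse of 0 are both
   0. *)
move: u0; rewrite le_eqVlt => /orP[/eqP<-|u0]; last by rewrite powR_inv1// ltW.
by rewrite invr0 powR0// oppr_eq0 oner_eq0.
Qed.

Lemma gauge_ge0 x : 0 <= g x.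
Proof. by rewrite mulr_ge0// powR_ge0. Qed.

Lemma expR_ln_itv (x : R) : 0 < x -> x < 1 -> exists2 u, 0 < u & x = expR (- u).
Proof.
move=> x0 x1; exists (- ln x); last by rewrite opprK lnK.
by rewrite oppr_gt0 ln_lt0// x0.
Qed.

Lemma gauge_gt0 x : 0 < x -> x < 1 -> 0 < g x.
Proof.
move=> x0 /(expR_ln_itv x0)[u u0 ->].
by rewrite gauge_expR ?ltW// divr_gt0// expR_gt0.
Qed.

Lemma gauge_mono x y : 0 < x -> x <= y -> y < 1 -> g x <= g y.
Proof.
move=> x0 xy y1; have [u u0 xE] := expR_ln_itv x0 (le_lt_trans xy y1).
have [v v0 yE] := expR_ln_itv (lt_le_trans x0 xy) y1.
move: xy; rewrite xE yE ler_expR lerN2 => vu.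
rewrite !gauge_expR ?(ltW u0) ?(ltW v0)//.
apply: ler_pM => //; rewrite ?expR_ge0 ?invr_ge0 ?(ltW u0)//.
  by rewrite ler_expR lerN2 ler_pM2l.
by rewrite lef_pV2.
Qed.

(** For [x = exp (- u)] the quotient [g x / x] is [exp (b u) / u], which increases with [u] from
    [u = 1 / b] on; hence the bound on [y]. *)
Lemma gauge_ratio x y : 0 < x -> x <= y -> y <= expR (- b^-1) -> x * g y <= y * g x.
Proof.
move=> x0 xy yb; have y0 := lt_le_trans x0 xy.
have y1 : y < 1.
  by apply: le_lt_trans yb _; rewrite -expR0 ltr_expR oppr_lt0 invr_gt0.
have [u u0 xE] := expR_ln_itv x0 (le_lt_trans xy y1).
have [v v0 yE] := expR_ln_itv y0 y1.
move: xy yb; rewrite xE yE !ler_expR !lerN2 => vu bv.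
rewrite !gauge_expR ?(ltW u0) ?(ltW v0)//.
rewrite mulrA [leRHS]mulrA ler_pdivrMr// [leRHS]mulrAC ler_pdivlMr// -!expRD.
have -> : - u + - (a * v) = (- v + - (a * u)) + b * (v - u) by rewrite /b; ring.
set w := - v + _; rewrite (expRD w) -mulrA ler_pM2l ?expR_gt0// -ler_pdivlMl ?expR_gt0//.
rewrite -expRN; have := expR_ge1Dx (- (b * (v - u))).
have : 1 <= b * v by rewrite -ler_pdivrMl// mulr1.
move=> h1 h2; apply: (@le_trans _ _ ((1 + - (b * (v - u))) * v)).
  have -> : (1 + - (b * (v - u))) * v = u + (u - v) * (b * v - 1) by ring.
  by rewrite lerDl mulr_ge0// subr_ge0.
by rewrite ler_pM2r.
Qed.

(** Here [x / g x = u * exp (- b u)], and [exp (b u) >= (b u / 2)^2] makes this at most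
    [4 / (b^2 u)], whence the choice of [v]. It turns a bound on the weight of a fine cover into a
    small total length. *)
Lemma gauge_density e : 0 < e ->
  exists2 d, 0 < d & forall x, 0 < x -> x <= d -> x <= e * g x.
Proof.
move=> e0; pose v := 4 / (e * b ^+ 2).
have v0 : 0 < v by rewrite divr_gt0// mulr_gt0// exprn_gt0.
exists (expR (- v)); first exact: expR_gt0.
move=> x x0 xv; have x1 : x < 1.
  by apply: le_lt_trans xv _; rewrite -expR0 ltr_expR oppr_lt0.
have [u u0 xE] := expR_ln_itv x0 x1.
move: xv; rewrite xE ler_expR lerN2 => vu.
rewrite gauge_expR ?(ltW u0)// mulrA ler_pdivlMr//.
have -> : - (a * u) = - u + b * u by rewrite /b; ring.
rewrite (expRD (- u)) [leRHS]mulrCA ler_wpM2l ?expR_ge0// [leRHS]mulrC.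
have -> : b * u = b * u / 2 + b * u / 2 by field.
have h : 1 + b * u / 2 <= expR (b * u / 2) by exact: expR_ge1Dx.
have bu : 0 < b * u by rewrite mulr_gt0.
rewrite expRD; apply: (@le_trans _ _ (b * u / 2 * (b * u / 2) * e)).
  have -> : b * u / 2 * (b * u / 2) * e = u * (u * (e * b ^+ 2) / 4) by field.
  apply: ler_peMr; first exact: ltW.
  rewrite ler_pdivlMr// mul1r -ler_pdivrMr//.
  by rewrite mulr_gt0// exprn_gt0.
by rewrite ler_pM2r// ler_pM//; lra.
Qed.

(** This is [32^(- n tau)], at most [q^(- tau)] for every denominator [q] of level [n], written as
    an exponential to match [gauge_expR]. *)
Definition radius (n : nat) : R := expR (- (n%:R * (tau * ln 32))).

Let ln32 : 0 < ln 32 :> R. Proof. by rewrite ln_gt0// ltr1n. Qed.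

Lemma radius_gt0 n : 0 < radius n. Proof. exact: expR_gt0. Qed.

Lemma radius_noninc n m : (n <= m)%N -> radius m <= radius n.
Proof.
move=> nm; rewrite ler_expR lerN2 ler_wpM2r ?ler_nat// mulr_ge0// ltW//.
Qed.

Lemma expR_ln32 n : expR (n%:R * (2 * ln 32)) = 1024 ^+ n :> R.
Proof.
rewrite !expRM_natl lnK; last by rewrite posrE ltr0n.
by rewrite expr2 (_ : 32 * 32 = 1024 :> R)//; ring.
Qed.

(** The terms are the powers of [32^(2 - tau)], a ratio below 1 because [tau > 2]. *)
Lemma radius_small e : 0 < e -> exists L0, forall L L', (L0 <= L)%N ->
  \sum_(L <= m < L') 1024 ^+ m * radius m <= e.
Proof.
move=> e0; pose q := expR (- ((tau - 2) * ln 32)).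
have q0 : 0 <= q by exact: expR_ge0.
have q1 : q < 1.
  rewrite /q -[ltRHS]expR0 ltr_expR oppr_lt0; apply: (mulr_gt0 _ ln32).
  by rewrite subr_gt0.
have e1 : 0 < e * (1 - q) by rewrite mulr_gt0// ?subr_gt0.
have [L0 h] := expr_small q0 q1 e1; exists L0 => L L' LL.
have -> : \sum_(L <= m < L') 1024 ^+ m * radius m = \sum_(L <= m < L') q ^+ m.
  apply: eq_bigr => m _; rewrite -expR_ln32 /radius -expRD /q -expRM_natl.
  by congr expR; ring.
apply: le_trans (sum_geometric_le _ _ q0 q1) _.
by rewrite ler_pdivrMr ?subr_gt0// h.
Qed.

(** The exponent [2 / tau] cancels [tau] and leaves [32^(- 2 n)], while the logarithm of the inverse
    radius is linear in [n]: this is the source of the harmonic series in [gauge_div]. *)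
Lemma gauge_radius n : g (radius n) = (1024 ^+ n)^-1 / (n%:R * (tau * ln 32)).
Proof.
rewrite gauge_expR ?mulr_ge0// ?ltW//; congr (_ / _).
rewrite -expR_ln32 -expRN; congr expR; rewrite /a; field.
by rewrite gt_eqF.
Qed.

Lemma gauge_radius_half n : (0 < n)%N -> g (radius n.+1) <= g (radius n) / 2.
Proof.
move=> n0; rewrite !gauge_radius exprS; have ln0 := ln32; have B0 := base_gt0 R n.
rewrite -mulrA -!invfM lef_pV2 ?posrE ?mulr_gt0 ?ltr0n//.
have X0 : 0 < 1024 ^+ n * (tau * ln 32) by apply: mulr_gt0 B0 _; exact: mulr_gt0.
have -> : 1024 ^+ n * (n%:R * (tau * ln 32) * 2) = 1024 ^+ n * (tau * ln 32) * (2 * n%:R).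
  by ring.
have -> : 1024 * 1024 ^+ n * (n.+1%:R * (tau * ln 32)) =
    1024 ^+ n * (tau * ln 32) * (1024 * n.+1%:R).
  by move: (1024 ^+ n) => B; ring.
by rewrite ler_pM2l// -!natrM ler_nat leq_mul.
Qed.

(** The weights at least halve from each level to the next, so the sum is at most twice its first
    term, whose radius is at most [x]. Level 0, where the halving fails, is excluded since
    [radius 0 = 1 > x]. *)
Lemma gauge_tail x L L' : 0 < x -> x <= expR (- 1) ->
  \sum_(L <= n < L' | radius n <= x) g (radius n) <= 2 * g x.
Proof.
move=> x0 xe; have x1 : x < 1.
  by apply: le_lt_trans xe _; rewrite -[ltRHS]expR0 ltr_expR oppr_lt0.
have gx := gauge_ge0 x.
have [|LL'] := leqP L' L; first by move=> h; rewrite big_geq// mulr_ge0.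
have [k ->] : exists k, L' = (L + k)%N by exists (L' - L)%N; rewrite subnKC// ltnW.
elim: k L {LL'} => [|k IH] L.
  by rewrite addn0 big_geq// mulr_ge0.
rewrite big_ltn_cond ?addnS ?ltnS ?leq_addr//; case: ifP => rLx; last first.
  by rewrite -addSn; exact: IH.
have L0 : (0 < L)%N.
  rewrite lt0n; apply/eqP => L0; move: rLx; rewrite L0 /radius mul0r oppr0 expR0.
  by rewrite leNgt x1.
apply: (@le_trans _ _ (2 * g (radius L))); last first.
  by rewrite ler_pM2l// gauge_mono// radius_gt0.
have E j m : (0 < m)%N -> \sum_(m <= n < m + j) g (radius n) <=
    2 * g (radius m) - 2 * g (radius (m + j)).
  move=> m0; elim: j => [|j IHj]; first by rewrite addn0 big_geq// subrr.
  rewrite addnS big_nat_recr; last exact: leq_addr.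
  have := gauge_radius_half (ltn_addr j m0); move: IHj.
  move: (\sum_(_ <= _ < _) _) (g (radius m)) (g (radius (m + j))) (g (radius (m + j).+1)).
  by move=> p q u v /= h1 h2; lra.
apply: (@le_trans _ _ (\sum_(L <= n < L + k.+1) g (radius n))).
  rewrite [leRHS]big_ltn; last by rewrite addnS ltnS leq_addr.
  rewrite lerD2l big_mkcond addnS.
  by apply: ler_sum => n _; case: ifP => // _; exact: gauge_ge0.
apply: le_trans (E _ _ L0) _.
by rewrite gerBl mulr_ge0// gauge_ge0.
Qed.

Lemma harmonic_tail_unbounded (L : nat) (M : R) :
  exists L', M <= \sum_(L <= n < L') n%:R^-1.
Proof.
apply: contrapT => h; apply: (@dvg_harmonic R).
have hM N : \sum_(L <= n < N) n%:R^-1 <= M.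
  by rewrite leNgt; apply/negP => /ltW hN; apply: h; exists N.
apply: nondecreasing_is_cvgn.
  apply/nondecreasing_seqP => n; rewrite !seriesEnat/= big_nat_recr//= lerDl.
  by rewrite invr_ge0.
exists (\sum_(0 <= n < L.+1) n%:R^-1 + M) => _ [n _ <-].
rewrite seriesEnat/=.
apply: (@le_trans _ _ (\sum_(0 <= k < (maxn L n).+1) k%:R^-1)).
  rewrite [leRHS]big_nat_recl//= invr0 add0r.
  by apply: sum_nat_widen; [move=> i; rewrite invr_ge0|rewrite leq_maxr].
rewrite (@big_cat_nat _ _ _ L)//=; last by rewrite leqW// leq_maxl.
by apply: lerD => //; apply: sum_nat_widen => // i; rewrite invr_ge0.
Qed.

Lemma gauge_div L M : exists L', M <= \sum_(L <= n < L') 1024 ^+ n * g (radius n).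
Proof.
have t0 : 0 < tau * ln 32 by exact: mulr_gt0.
have [L' h] := harmonic_tail_unbounded L (M * (tau * ln 32)); exists L'.
move: h; rewrite -ler_pdivlMr// mulr_suml => /le_trans; apply.
apply: ler_sum => n _; rewrite gauge_radius.
by rewrite [leRHS]mulrA mulfV ?mul1r ?invfM ?gt_eqF ?base_gt0.
Qed.

End gauge.

(** * Terms of the series *)

Lemma norm_sin_le (R : realType) (y : R) : `|sin y| <= `|y|.
Proof.
wlog y0 : y / 0 <= y => [H|].
  have [/H//|/ltW y0] := leP 0 y.
  by have := H (- y); rewrite sinN !normrN oppr_ge0; apply.
have [|c _] := MVT_segment y0 (fun x _ => is_derive_sin x).
  by apply: continuous_subspaceT; exact: continuous_sin.
rewrite sin0 !subr0 => ->; rewrite normrM -[leRHS]mul1r ler_wpM2r//.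
exact: cos_max.
Qed.

(** From [sin y = 2 sin (y / 2) cos (y / 2)] and the mean value theorem for [sin (y / 2)], two
    cosines at points of [[0, pi / 4]] appear; each is at least [cos (pi / 4)], whose square is
    1/2. *)
Lemma norm_sin_ge (R : realType) (y : R) : `|y| <= pi / 2 -> `|y| / 2 <= `|sin y|.
Proof.
wlog y0 : y / 0 <= y => [H|].
  have [/H//|/ltW y0] := leP 0 y.
  by have := H (- y); rewrite sinN !normrN oppr_ge0; apply.
rewrite (ger0_norm y0) => yp; apply: le_trans (ler_norm _).
have pi0 := pi_gt0 R.
have z0 : 0 <= y / 2 by lra.
have [|c cz] := MVT_segment z0 (fun x _ => is_derive_sin x).
  by apply: continuous_subspaceT; exact: continuous_sin.
move: cz; rewrite in_itv /= => /andP[c0 cz].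
rewrite sin0 !subr0 => sz.
have cos_ge (w : R) : 0 <= w -> w <= pi / 2 / 2 -> cos (pi / 2 / 2) <= cos w.
  move=> w0; rewrite le_eqVlt => /orP[/eqP->//|wp]; apply/ltW.
  by rewrite ltr_cos// in_itv/=; apply/andP; split; lra.
have c4 : cos (pi / 2 / 2 : R) ^+ 2 = 1 / 2.
  have := cos_mulr2n (pi / 2 / 2 : R).
  have -> : (pi / 2 / 2 : R) *+ 2 = pi / 2 by rewrite -mulr_natr; field.
  by rewrite cos_pihalf -mulr_natr; lra.
have c40 : 0 <= cos (pi / 2 / 2 : R).
  by apply/ltW/cos_gt0_pihalf; apply/andP; split; lra.
have -> : sin y = 2 * (cos (y / 2) * (cos c * (y / 2))).
  by rewrite -sz mulr_natl -sin_mulr2n -mulr_natr; congr sin; field.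
have h1 : cos (pi / 2 / 2) <= cos (y / 2) by apply: cos_ge; lra.
have h2 : cos (pi / 2 / 2) <= cos c by apply: cos_ge; lra.
have h3 : 1 / 2 <= cos (y / 2) * cos c by rewrite -c4 expr2 ler_pM.
have : 1 / 2 * (y / 2) <= cos (y / 2) * cos c * (y / 2) by rewrite ler_wpM2r.
rewrite -[cos (y / 2) * cos c * _]mulrA; move: (cos (y / 2) * (cos c * (y / 2))) => w; lra.
Qed.

Lemma norm_sin_shift (R : realType) (y : R) (p : int) :
  `|sin (y - pi * p%:~R)| = `|sin y|.
Proof.
have H (z : R) (n : nat) : `|sin (z + pi * n%:R)| = `|sin z|.
  elim: n z => [|n IH] z; first by rewrite mulr0 addr0.
  by rewrite -natr1 mulrDr mulr1 addrA sinDpi normrN.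
case: p => n.
  by rewrite -(H (y - _) n) -pmulrn subrK.
by rewrite NegzE mulrNz mulrN opprK -pmulrn H.
Qed.

Definition nearest_int (R : realType) (y : R) : int := Num.floor (y + 1 / 2).

Definition int_dist (R : realType) (y : R) : R := `|y - (nearest_int y)%:~R|.

Lemma int_dist_le_half (R : realType) (y : R) : int_dist y <= 1 / 2.
Proof.
have /andP[] := floor_itv (y + 1 / 2); rewrite intrD.
by rewrite /int_dist /nearest_int ler_norml => ? ?; apply/andP; split; lra.
Qed.

Lemma int_dist_le (R : realType) (y : R) (p : int) : int_dist y <= `|y - p%:~R|.
Proof.
have [->//|ne] := eqVneq p (nearest_int y).
have h : 1 <= `|(nearest_int y - p)%:~R| :> R.
  by rewrite -intr_norm -[1]/(1%:~R) ler_int -gtz0_ge1 normr_gt0 subr_eq0 eq_sym.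
apply: (le_trans (int_dist_le_half y)).
have -> : y - p%:~R = (nearest_int y - p)%:~R + (y - (nearest_int y)%:~R).
  by rewrite intrB; ring.
have := lerB_normD (nearest_int y - p)%:~R (y - (nearest_int y)%:~R).
have := int_dist_le_half y; rewrite -/(int_dist y); lra.
Qed.

Lemma int_dist_le_sin (R : realType) (y : R) : int_dist y <= `|sin (pi * y)|.
Proof.
rewrite -(norm_sin_shift _ (nearest_int y)) -mulrBr.
have pi0 := pi_gt0 R; have pi2 := pi_ge2 R.
have h := int_dist_le_half y.
apply: le_trans (norm_sin_ge _); rewrite normrM (gtr0_norm pi0) -/(int_dist y).
  have : 0 <= int_dist y by exact: normr_ge0.
  by move: (int_dist y) h => d ? ?; nra.
by move: (int_dist y) h => d ?; nra.
Qed.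

Lemma int_dist_gt0 (R : realType) (x : R) (q : nat) :
  irrational x -> (0 < q)%N -> 0 < int_dist (q%:R * x).
Proof.
move=> ix q0; rewrite normr_gt0 subr_eq0; apply/eqP => e; apply: ix.
have q0R : 0 < q%:R :> R by rewrite ltr0n.
apply/rationalP; exists (nearest_int (q%:R * x)), q.
by rewrite -e mulrC mulKf// gt_eqF.
Qed.

Lemma nneseries_le_bound (R : realType) (u : nat -> R) (m : nat) (M : R) :
  (forall i, 0 <= u i) -> (forall N, \sum_(m <= i < N) u i <= M) ->
  (\sum_(m <= i <oo) (u i)%:E <= M%:E)%E.
Proof.
move=> u0 uM; apply: lime_le.
  by apply: is_cvg_nneseries => n _ _; rewrite lee_fin.
by near=> N; rewrite sumEFin lee_fin.
Unshelve. all: by end_near. Qed.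

Lemma nneseries_ge_partial (R : realType) (u : nat -> R) (m N : nat) :
  (forall i, 0 <= u i) ->
  ((\sum_(m <= i < N) u i)%:E <= \sum_(m <= i <oo) (u i)%:E)%E.
Proof.
move=> u0; rewrite -sumEFin; apply: (@nneseries_lim_ge _ _ xpredT) => n _ _.
by rewrite lee_fin.
Qed.

Definition term (R : realType) (s t x : R) (n : nat) : R :=
  n%:R `^ (- s) * `|sin (pi * n%:R * x)| `^ (- t).

Lemma term_ge0 (R : realType) (s t x : R) (n : nat) : 0 <= term s t x n.
Proof. by rewrite mulr_ge0 ?powR_ge0. Qed.

Lemma Dset_unbounded (R : realType) (s t x : R) :
  Dset s t x <-> irrational x /\ forall M, exists N, M < \sum_(1 <= n < N) term s t x n.
Proof.
split=> -[ix h]; split => //.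
  move=> M; apply: contrapT => hM.
  have : (\sum_(1 <= n <oo) (term s t x n)%:E <= M%:E)%E.
    apply: nneseries_le_bound => [i|N]; first exact: term_ge0.
    by rewrite leNgt; apply/negP => hN; apply: hM; exists N.
  by rewrite h.
apply/eqyP => M _; have [N /ltW hN] := h M.
apply: le_trans (nneseries_ge_partial 1 N (term_ge0 s t x)).
by rewrite lee_fin.
Qed.

(** The approximation gives [|sin (pi q x)| <= pi * q^(- s / t)], and the power [- t] of
    [q^(- s / t)] cancels the factor [q^(- s)]. *)
Lemma term_frac_ge (R : realType) (s t x : R) (p q : nat) :
  0 < t -> irrational x -> (0 < q)%N ->
  `|x - p%:R / q%:R| <= q%:R `^ (- (1 + s / t)) -> pi `^ (- t) <= term s t x q.
Proof.
move=> t0 ix q0 xq.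
have q0R : 0 < q%:R :> R by rewrite ltr0n.
have pi0 := pi_gt0 R.
have sE : `|sin (pi * q%:R * x)| = `|sin (pi * q%:R * x - pi * p%:R)|.
  by rewrite -(norm_sin_shift _ p%:Z) -pmulrn.
have s_le : `|sin (pi * q%:R * x)| <= pi * q%:R `^ (- (s / t)).
  rewrite sE; apply: le_trans (norm_sin_le _) _.
  have -> : pi * q%:R * x - pi * p%:R = pi * (q%:R * (x - p%:R / q%:R)).
    by field; rewrite gt_eqF.
  rewrite normrM (gtr0_norm pi0) ler_pM2l// normrM (gtr0_norm q0R).
  have -> : q%:R `^ (- (s / t)) = q%:R * q%:R `^ (- (1 + s / t)) :> R.
    rewrite -{2}(powRr1 (ltW q0R)) -powRD; last by apply/implyP => _; rewrite gt_eqF.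
    by congr (_ `^ _); ring.
  by rewrite ler_pM2l.
(* A vanishing sine would make the term 0, because [powR] sends 0 to 0 for a nonzero exponent;
   irrationality rules this out. *)
have s_gt0 : 0 < `|sin (pi * q%:R * x)|.
  rewrite -mulrA; apply: lt_le_trans (int_dist_le_sin _).
  exact: int_dist_gt0.
rewrite /term.
have -> : pi `^ (- t) = q%:R `^ (- s) * (pi * q%:R `^ (- (s / t))) `^ (- t) :> R.
  rewrite powRM ?powR_ge0 ?(ltW pi0)// -powRrM mulrCA -powRD.
    have -> : - s + - (s / t) * - t = 0 by field; rewrite gt_eqF.
    by rewrite powRr0 mulr1.
  by apply/implyP => _; rewrite gt_eqF.
have A0 : 0 < pi * q%:R `^ (- (s / t)) :> R by rewrite mulr_gt0 ?powR_gt0.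
apply: ler_wpM2l; first exact: powR_ge0.
set A := pi * _ in A0 s_le *.
rewrite !powRN lef_pV2 ?posrE ?powR_gt0//.
exact: (ge0_ler_powR (ltW t0) (ltW s_gt0 : _ \is Num.nneg) (ltW A0 : _ \is Num.nneg) s_le).
Qed.

Lemma radius_le_powR (R : realType) (tau : R) (n q : nat) :
  0 < tau -> (0 < q)%N -> (q <= 32 ^ n)%N -> radius tau n <= q%:R `^ (- tau).
Proof.
move=> tau0 q0 qn; have q0R : 0 < q%:R :> R by rewrite ltr0n.
rewrite /powR gt_eqF// /radius ler_expR mulNr lerN2 mulrCA ler_pM2l//.
rewrite mulr_natl -lnXn ?ltr0n// ler_ln ?posrE ?exprn_gt0 ?ltr0n//.
by rewrite -natrX ler_nat.
Qed.

Lemma Dset_of_approx (R : realType) (s t x : R) : 0 < t -> 0 < s -> irrational x ->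
  (forall n1, exists n y, [/\ (n1 <= n)%N, y \in level R n & `|x - y| <= radius (1 + s / t) n]) ->
  Dset s t x.
Proof.
move=> t0 s0 ix approx; apply/Dset_unbounded; split=> // M.
have c0 : 0 < pi `^ (- t) :> R by rewrite powR_gt0// pi_gt0.
suff H k : exists N, k%:R * pi `^ (- t) <= \sum_(1 <= n < N) term s t x n.
  have [N hN] := H (Num.truncn (M / pi `^ (- t))).+1; exists N.
  apply: lt_le_trans hN; rewrite -ltr_pdivrMr//; exact: truncnS_gt.
elim: k => [|k [N IH]]; first by exists 0%N; rewrite mul0r big_geq.
have [n [y [Nn /fracsP[p [q [/andP[nq qn] pq _ yE]]] xy]]] := approx N.+1.
have q0 : (0 < q)%N by apply: leq_trans nq; rewrite expn_gt0.
have Nq : (N <= q)%N.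
  apply: leq_trans nq; apply: ltnW; apply: leq_trans (ltn_expl _ (isT : 1 < 32)%N) _.
  by rewrite leq_exp2l//; case: n Nn {qn xy}.
exists q.+1; rewrite big_nat_recr//= -natr1 mulrDl mul1r; apply: lerD.
  exact: le_trans IH (sum_nat_widen _ _ (term_ge0 _ _ _) Nq).
apply: (@term_frac_ge _ _ _ _ p) => //; rewrite -yE.
apply: le_trans xy _; apply: radius_le_powR => //; last exact: ltnW.
by rewrite addr_gt0// divr_gt0.
Qed.

(** * Infinite measure *)

Lemma gauge_arbitrarily_small (R : realType) (tau d e : R) : 2 < tau -> 0 < d -> 0 < e ->
  exists2 y, 0 < y <= d & log_gauge tau (-1) y <= e.
Proof.
move=> tau2 d0 e0; pose a := 2 / tau.
have a0 : 0 < a by rewrite divr_gt0// (lt_trans _ tau2).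
pose u := 1 + `|ln d| + 1 / (a * e).
have ae : 0 < 1 / (a * e) by rewrite divr_gt0// mulr_gt0.
have n0 := normr_ge0 (ln d); have u1 : 1 <= u by rewrite /u; lra.
exists (expR (- u)).
  rewrite expR_gt0/= -[leRHS](lnK d0) ler_expR.
  by have := ler_norm (- ln d); rewrite normrN /u; lra.
rewrite gauge_expR//; last lra.
apply: (@le_trans _ _ (expR (- (a * u)))).
  by rewrite ler_pdivrMr ?ler_peMr ?expR_ge0//; lra.
rewrite expRN invf_ple ?posrE ?expR_gt0//.
apply: le_trans (expR_ge1Dx _).
have : e^-1 <= a * u.
  have -> : e^-1 = a * (1 / (a * e)).
    by field; rewrite !gt_eqF.
  by rewrite ler_pM2l// /u; lra.
lra.
Qed.

(** For [x <= exp (- 1)] the base [ln (1 / x)] is at least 1, so its powers increase with the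
    exponent. *)
Lemma log_gauge_le (R : realType) (tau kappa : R) (x : R) :
  -1 <= kappa -> 0 < x -> x <= expR (- 1) -> log_gauge tau (-1) x <= log_gauge tau kappa x.
Proof.
move=> k1 x0 xe; rewrite ler_wpM2l ?powR_ge0//; apply: ler_powR => //.
by rewrite div1r lnV ?posrE// lerNr -[leRHS]expRK ler_ln ?posrE ?expR_gt0.
Qed.

Lemma diamP (R : realType) (U : set R) (d : R) : (diam U <= d%:E)%E ->
  [/\ 0 <= fine (diam U), fine (diam U) <= d &
      forall x y, U x -> U y -> `|x - y| <= fine (diam U)].
Proof.
move=> Ud; have U0 : (0%E <= diam U)%E by apply: ereal_sup_ubound; left.
have Uf : diam U \is a fin_num.
  by rewrite ge0_fin_numE//; apply: le_lt_trans Ud _; rewrite ltry.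
split; first exact: fine_ge0.
  by rewrite -lee_fin fineK.
move=> x y Ux Uy; rewrite -lee_fin fineK//; apply: ereal_sup_ubound; right.
by exists x => //; exists y.
Qed.

Lemma sum_double (R : realType) (F : nat -> R) (N : nat) :
  \sum_(0 <= i < N.*2) F i = \sum_(0 <= j < N) (F j.*2 + F j.*2.+1).
Proof.
elim: N => [|N IH]; first by rewrite !big_geq.
by rewrite doubleS !big_nat_recr//= IH addrA.
Qed.

Lemma sum_half_le (R : realType) (N : nat) : \sum_(0 <= j < N) (1 / 2) ^+ j <= 2 :> R.
Proof.
have E : (1 / 2) ^+ 0 / (1 - 1 / 2) = 2 :> R by field.
rewrite -[leRHS]E; by apply: sum_geometric_le; lra.
Qed.

Lemma hausdorff_Dset_infinite (R : realType) (s t kappa : R) (h : R -> R) :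
  1 < t -> t < s -> -1 <= kappa -> log_dimension_function (1 + s / t) kappa h ->
  hausdorff_measure h (Dset s t) = +oo%E.
Proof.
move=> t1 ts k1 [[h0 hmono _] [r0 [r00 r01 _ hE]]].
have t0 : 0 < t by exact: lt_trans t1.
have s0 : 0 < s by exact: lt_trans ts.
set tau := 1 + s / t in hE.
have tau2 : 2 < tau.
  have : 1 < s / t by rewrite ltr_pdivlMr// mul1r.
  by rewrite /tau; lra.
pose g := log_gauge tau (-1).
pose theta : R := (64 * 256)^-1.
have theta0 : 0 < theta by rewrite invr_gt0 mulr_gt0 ?ltr0n.
have theta_small : 64 * (256 * theta) <= 1.
  by rewrite mulrA mulfV ?gt_eqF ?mulr_gt0 ?ltr0n.
have h_ge0 x : 0 <= x -> 0 <= h x.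
  by move=> x0; rewrite -h0 hmono// in_itv/= ?lexx ?x0.
apply/cvg_lim => //; apply/cvgeyPge => S.
have S4 : 0 < `|S| + 4 by rewrite ltr_wpDl.
(* The balls built below have total weight at most [|S| + 4]: every [eta j] is counted at most
   twice, with weight at most [(1 / 2)^j]. This density then bounds their total length by
   [theta / 2], as [avoiding_point] requires. *)
have e0 : 0 < theta / (2 * (`|S| + 4)) by apply: divr_gt0 => //; exact: mulr_gt0.
have [d d0 hd] := gauge_density tau2 e0.
near=> dl.
have dl0 : 0 < dl by near: dl; exact: nbhs_right_gt.
have dld : dl <= d by near: dl; exact: nbhs_right_le.
have dle : dl <= expR (- 1).
  by near: dl; apply: nbhs_right_le; exact: expR_gt0.
have dlb : dl <= expR (- (1 - 2 / tau)^-1).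
  by near: dl; apply: nbhs_right_le; exact: expR_gt0.
have dlr : dl < r0 by near: dl; exact: nbhs_right_lt.
have dl1 : dl < 1 by apply: lt_le_trans dlr _.
apply: le_ereal_inf_tmp => _ [U [UD Udl] <-].
rewrite leNgt; apply/negP => US.
pose D i := fine (diam (U i)).
have D_itv i : 0 <= D i <= dl by have [? ? _] := diamP (Udl i); apply/andP.
have hD_ge0 i : 0 <= h (D i) by apply: h_ge0; case/andP: (D_itv i).
have hS N : \sum_(0 <= i < N) h (D i) <= S.
  rewrite -lee_fin; apply: le_trans (ltW US).
  exact: nneseries_ge_partial.
have gh i : g (D i) <= h (D i).
  have /andP[] := D_itv i; rewrite le_eqVlt => /orP[/eqP<- _|Di0 Didl].
    by rewrite h0 /g /log_gauge powR0 ?mul0r// gt_eqF// divr_gt0// (lt_trans _ tau2).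
  rewrite hE; last by rewrite in_itv/= Di0 (le_lt_trans Didl).
  by apply: log_gauge_le => //; exact: le_trans Didl _.
have [eta etaP] : {eta : nat -> R & forall j, 0 < eta j <= dl /\ g (eta j) <= (1 / 2) ^+ j}.
  apply: (@choice _ _ (fun j y => 0 < y <= dl /\ g y <= (1 / 2) ^+ j)) => j.
  have [|y ? ?] := @gauge_arbitrarily_small _ tau dl ((1 / 2) ^+ j) tau2 dl0.
    by rewrite exprn_gt0.
  by exists y.
(* Odd indices carry a small ball around each rational, which forces the avoiding point to be
   irrational. Even indices carry a ball containing the set of the cover, centred at one of its
   points (at 0 if it is empty); [eta] makes the radius positive when the diameter is 0. *)
pose rt (j : nat) : R := ratr (odflt 0 (unpickle j : option rat)).
pose c i := if odd i then rt i./2 else xget 0 (U i./2).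
pose rho i := if odd i then eta i./2 else Num.max (D i./2) (eta i./2).
have rho_itv i : 0 < rho i <= dl.
  have [/andP[e1 e2] _] := etaP i./2; have /andP[D1 D2] := D_itv i./2.
  rewrite /rho; case: ifP => _; first by rewrite e1 e2.
  by rewrite lt_max e1 orbT ge_max D2 e2.
have g_ge0 := gauge_ge0 tau.
have gsum N : \sum_(0 <= i < N) g (rho i) <= `|S| + 4.
  apply: (@le_trans _ _ (\sum_(0 <= i < N.*2) g (rho i))).
    by apply: sum_nat_widen => [i|]; [exact: g_ge0|rewrite -addnn leq_addr].
  rewrite sum_double.
  apply: (@le_trans _ _ (\sum_(0 <= j < N) (h (D j) + 2 * (1 / 2) ^+ j))).
    apply: ler_sum => j _; rewrite /rho /= odd_double/= uphalf_double doubleK.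
    have [_ e1] := etaP j; have := gh j; have := g_ge0 (D j); have := g_ge0 (eta j).
    rewrite -/g => eta0 D0 gD.
    have : g (Num.max (D j) (eta j)) <= g (D j) + g (eta j).
      by case: (leP (D j) (eta j)) => _; rewrite ?lerDl ?lerDr.
    move: (g (Num.max _ _)) (g (D j)) (g (eta j)) (h (D j)) ((1 / 2) ^+ j) e1 gD.
    by clear => *; lra.
  rewrite big_split/= -mulr_sumr.
  have -> : `|S| + 4 = `|S| + 2 * 2 by ring.
  apply: lerD; first exact: le_trans (hS N) (ler_norm S).
  by rewrite ler_pM2l// sum_half_le.
have rsum N : \sum_(0 <= i < N) rho i <= theta / 2.
  apply: (@le_trans _ _ (\sum_(0 <= i < N) theta / (2 * (`|S| + 4)) * g (rho i))).
    apply: ler_sum => i _; have /andP[? ?] := rho_itv i.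
    by apply: hd => //; exact: le_trans dld.
  rewrite -mulr_sumr; apply: le_trans (ler_wpM2l _ (gsum N)) _.
    by rewrite divr_ge0 ?mulr_ge0 ?(ltW theta0) ?(ltW S4).
  by rewrite le_eqVlt; apply/orP; left; apply/eqP; field; rewrite gt_eqF.
have g_gt0 x : 0 < x <= dl -> 0 < g x.
  by move=> /andP[x0 xd]; apply: gauge_gt0 => //; exact: le_lt_trans dl1.
have g_mono x y : 0 < x -> x <= y -> y <= dl -> g x <= g y.
  by move=> x0 xy yd; apply: gauge_mono => //; exact: le_lt_trans dl1.
have g_ratio x y : 0 < x -> x <= y -> y <= dl -> x * g y <= y * g x.
  by move=> x0 xy yd; apply: gauge_ratio => //; exact: le_trans dlb.
have g_tail x L L' : 0 < x -> x <= dl ->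
    \sum_(L <= n < L' | radius tau n <= x) g (radius tau n) <= 2 * g x.
  by move=> x0 xd; apply: gauge_tail => //; exact: le_trans dle.
have [x [xc xa]] := avoiding_point dl0 (@radius_gt0 _ tau) (radius_noninc tau2)
  (radius_small tau2) g_ge0 g_gt0 g_mono g_ratio g_tail (gauge_div tau2) c rho_itv
  theta0 theta_small gsum rsum.
have ix : irrational x.
  move=> [q _ qx]; have := xc (pickle q).*2.+1.
  rewrite /c /rho /= odd_double/= uphalf_double /rt pickleK/= qx subrr normr0.
  by have [/andP[/ltW + _] _] := etaP (pickle q) => /le_lt_trans /[apply]; rewrite ltxx.
have /UD[i _ Uix] : Dset s t x by exact: Dset_of_approx.
have := xc i.*2; rewrite /c /rho odd_double doubleK.
have Uc : U i (xget 0 (U i)) by apply: xgetI Uix.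
have [_ _ /(_ _ _ Uc Uix) h1] := diamP (Udl i).
by rewrite gt_max => /andP[+ _]; rewrite ltNge h1.
Unshelve. all: by end_near. Qed.

(** * Large blocks of the series are rare *)

Lemma ler_powR_base (R : realType) (x y r : R) :
  0 <= r -> 0 <= x -> x <= y -> x `^ r <= y `^ r.
Proof. by move=> r0 x0 xy; apply: ge0_ler_powR => //; exact: le_trans xy. Qed.

Lemma ltr_powR_base (R : realType) (x y r : R) :
  0 < r -> 0 <= x -> x < y -> x `^ r < y `^ r.
Proof. by move=> r0 x0 xy; apply: gt0_ltr_powR => //; exact: le_trans (ltW xy). Qed.

Lemma powR_nat_decr (R : realType) (alpha : R) (m n : nat) :
  0 < alpha -> (0 < m)%N -> (m <= n)%N -> n%:R `^ (- alpha) <= m%:R `^ (- alpha) :> R.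
Proof.
move=> a0 m0 mn; have n0 := leq_trans m0 mn.
rewrite !powRN lef_pV2 ?posrE ?powR_gt0 ?ltr0n//.
by apply: ler_powR_base; rewrite ?ler_nat// ltW.
Qed.

(* After an index m where b is large, b decays geometrically as long as it stays
   above C * theta ^ m, hence during a time proportional to m; so the large values
   are attained along a sequence growing geometrically. *)
Lemma sum_stretches_bounded (R : realType) (b : nat -> R) (q theta C alpha : R) (M0 : nat) :
  0 < q -> q < 1 -> 0 < theta -> theta < 1 -> 0 < C -> 0 < alpha ->
  (forall m, 0 <= b m) ->
  (forall m, (M0 <= m)%N -> b m <= m%:R `^ (- alpha)) ->
  (forall m, (M0 <= m)%N -> b m.+1 = q * b m \/ b m <= C * theta ^+ m) ->
  exists B, forall N, \sum_(0 <= m < N) b m <= B.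
Proof.
move=> q0 q1 th0 th1 C0 alpha0 b0 b_le b_step.
pose v (m : nat) : R := m%:R `^ (- alpha).
(* A value is called large when it exceeds [th^m]. Compared with [C * theta^m = C * th^m * th^m],
   the spare factor [th^m] absorbs both [C] and the ratio [(theta / q)^j] for [j] up to
   [m / (2 a)]. *)
pose th := Num.sqrt theta.
have thE : th ^+ 2 = theta by rewrite sqr_sqrtr// ltW.
have t0 : 0 < th by rewrite sqrtr_gt0.
have t1 : th < 1 by rewrite -[ltRHS]sqrtr1 ltr_sqrt.
have t0' := ltW t0.
have [a1 ha1] := expr_small t0' t1 (divr_gt0 q0 th0).
pose a := a1.+1.
have a_le : theta / q * th ^+ a <= 1.
  have := ha1 a (leqnSn _); rewrite ler_pdivlMr// => h.
  by rewrite mulrAC ler_pdivrMr// mul1r mulrC.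
have C0' : 0 < C^-1 by rewrite invr_gt0.
have [n1 hn1] := expr_small t0' t1 C0'.
(* For [m >= 4 * a] a stretch has length [k m >= m / (4 a)], so the index grows by the factor
   [1 + 1 / (4 a)] and [v] shrinks by [lambda]. For [m >= 2 * n1] the exponent [m - a * j >= n1]
   suffices to absorb [C]. *)
pose M1 := (M0 + 4 * a + 2 * n1)%N.
have M1P m : (M1 <= m)%N -> [/\ M0 <= m, 0 < m, 4 * a <= m & 2 * n1 <= m]%N.
  move=> h; have h4 : (4 * a <= m)%N.
    by apply: leq_trans h; rewrite /M1 -addnA addnCA leq_addr.
  split=> //; first by apply: leq_trans h; rewrite /M1 -addnA leq_addr.
    by apply: leq_trans h4; rewrite muln_gt0.
  by apply: leq_trans h; rewrite /M1 leq_addl.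
pose k (m : nat) := (m %/ (2 * a))%N.
pose lambda : R := (1 + (4 * a%:R)^-1) `^ (- alpha).
have a4 : 0 < 4 * a%:R :> R by rewrite mulr_gt0// ltr0n.
have lam1 : lambda < 1.
  rewrite /lambda powRN invf_lt1 ?powR_gt0 ?ltr_pwDl ?invr_ge0 ?(ltW a4)//.
  have p1 : 1 `^ alpha = 1 :> R by rewrite powR1.
  rewrite -[ltLHS]p1; apply: ltr_powR_base => //.
  by rewrite ltrDl invr_gt0.
have vk m : (M1 <= m)%N -> v (m + k m)%N <= lambda * v m.
  move=> Mm; have [_ m0 ma _] := M1P m Mm.
  rewrite /v /lambda -powRM; [|by rewrite addr_ge0// invr_ge0 ltW|by []].
  rewrite !powRN lef_pV2 ?posrE ?powR_gt0 ?ltr0n ?addn_gt0 ?m0//; last first.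
    by rewrite mulr_gt0 ?ltr0n// ltr_pwDl// invr_ge0 ltW.
  apply: ler_powR_base; first exact: ltW.
    by rewrite mulr_ge0// addr_ge0// invr_ge0 ltW.
  rewrite mulrDl mul1r natrD lerD2l mulrC ler_pdivrMr//.
  rewrite -!natrM ler_nat.
  have a0 : (0 < a)%N by [].
  have := ltn_pmod m (isT : 0 < 2 * a)%N; have := divn_eq m (2 * a); rewrite -/(k m).
  move: (k m) (m %% (2 * a))%N ma a0; move: (a) => a'; clear => ? ? *; nia.
have kpos m : (M1 <= m)%N -> (0 < k m)%N.
  move=> Mm; have [_ _ ma _] := M1P m Mm.
  by rewrite /k divn_gt0 ?muln_gt0//; apply: leq_trans ma; rewrite leq_mul2r orbT.
have v_ge0 m : 0 <= v m by exact: powR_ge0.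
have stretch m : (M1 <= m)%N -> th ^+ m < b m ->
    forall j, (j <= k m)%N -> b (m + j)%N = q ^+ j * b m.
  move=> Mm bm; have [M0m m0 ma mn] := M1P m Mm; elim=> [|j IH] jk; first by rewrite addn0 mul1r.
  have {}IH := IH (ltnW jk).
  have [|e|h] := b_step (m + j)%N; first by rewrite (leq_trans M0m)// leq_addr.
    by rewrite addnS e IH exprS mulrA.
  exfalso; move: h; apply/negP; rewrite -ltNge IH.
  apply: (@le_lt_trans _ _ (q ^+ j * th ^+ m)); last by rewrite ltr_pM2l ?exprn_gt0.
  have aj : (2 * (a * j) <= m)%N.
    by rewrite mulnA mulnC (leq_trans _ (leq_divM m (2 * a)))// leq_mul2r (ltnW jk) orbT.
  have E1 : (theta / q) ^+ j * th ^+ (a * j) <= 1.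
    rewrite exprM -exprMn; apply: exprn_ile1 => //.
    by apply: mulr_ge0; [exact: ltW (divr_gt0 th0 q0)|exact: exprn_ge0].
  have E2 : C * th ^+ (m - a * j) <= 1.
    by rewrite -ler_pdivlMl// mulr1 hn1//; move: (a * j)%N mn aj; clear => *; lia.
  have -> : C * theta ^+ (m + j) =
      q ^+ j * th ^+ m * (((theta / q) ^+ j * th ^+ (a * j)) * (C * th ^+ (m - a * j))).
    rewrite exprD exprMn exprVn -{1}thE -exprM mul2n -addnn exprD.
    have -> : th ^+ m * th ^+ m = th ^+ m * (th ^+ (a * j) * th ^+ (m - a * j)).
      by rewrite -[in RHS]exprD subnKC//; apply: leq_trans aj; rewrite leq_pmull.
    by field; rewrite expf_neq0// gt_eqF.
  rewrite ler_piMr// ?mulr_ge0 ?exprn_ge0 ?(ltW q0)//.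
  apply: mulr_ile1 => //; rewrite mulr_ge0 ?exprn_ge0 ?(ltW C0)//.
  by rewrite divr_ge0// ltW.
(* [A] solves [A = 1 / (1 - q) + A * lambda]: the cost of one stretch plus the bound for all that
   follows it. *)
pose A := ((1 - q) * (1 - lambda))^-1.
have q1' : 0 < 1 - q by rewrite subr_gt0.
have l1' : 0 < 1 - lambda by rewrite subr_gt0.
have A0 : 0 <= A by rewrite invr_ge0 mulr_ge0// ltW.
have main n : forall m N, (N - m <= n)%N -> (M1 <= m)%N ->
    \sum_(m <= j < N) b j <= \sum_(m <= j < N) th ^+ j + A * v m.
  elim: n => [|n IH] m N Nm Mm.
    have {}Nm : (N <= m)%N by move: Nm; rewrite leqn0 subn_eq0.
    by rewrite !big_geq// add0r mulr_ge0.
  have [M0m m0 ma mn] := M1P m Mm.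
  have [Nm'|mN] := leqP N m; first by rewrite !big_geq// add0r mulr_ge0.
  have [bm|bm] := leP (b m) (th ^+ m).
    rewrite big_ltn// [X in _ <= X + _]big_ltn// -addrA; apply: lerD => //.
    apply: le_trans (IH m.+1 N _ _) _; [by move: Nm mN; clear; lia|by rewrite leqW|].
    by rewrite lerD2l ler_wpM2l// powR_nat_decr.
  have sk : \sum_(m <= j < m + k m) b j <= v m / (1 - q).
    have bmv : b m <= v m by exact: b_le.
    have -> : \sum_(m <= j < m + k m) b j = b m * \sum_(0 <= j < k m) q ^+ j.
      rewrite -{1}[m]add0n [(m + k m)%N]addnC big_addn addnK mulr_sumr.
      rewrite big_nat_cond [RHS]big_nat_cond; apply: eq_bigr => j /andP[/andP[_ jk] _].
      by rewrite addnC stretch// ?(ltnW jk)// mulrC.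
    apply: ler_pM => //; first by rewrite sumr_ge0// => j _; rewrite exprn_ge0// ltW.
    by apply: le_trans (sum_geometric_le _ _ (ltW q0) q1) _; rewrite expr0 div1r.
  have AE : A * v m = v m / (1 - q) + A * (lambda * v m).
    by rewrite /A; field; rewrite !gt_eqF.
  have h0 : 0 <= \sum_(m <= j < N) th ^+ j by rewrite sumr_ge0// => j _; rewrite exprn_ge0.
  have kp := kpos m Mm.
  have [Nk|kN] := leqP N (m + k m).
    apply: (@le_trans _ _ (v m / (1 - q))); first exact: le_trans (sum_nat_widen _ _ b0 Nk) sk.
    by rewrite AE addrCA lerDl addr_ge0// mulr_ge0// mulr_ge0// powR_ge0.
  rewrite (@big_cat_nat _ _ _ (m + k m)%N) ?leq_addr ?(ltnW kN)//=.
  apply: le_trans (lerD sk (IH (m + k m)%N N _ _)) _; [by move: (k m) Nm kp; clear => *; lia|by rewrite (leq_trans Mm)// leq_addr|].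
  rewrite AE [leRHS]addrCA lerD2l.
  apply: lerD; last by rewrite ler_wpM2l// vk.
  rewrite [leRHS](@big_cat_nat _ _ _ (m + k m)%N) ?leq_addr ?(ltnW kN)//= lerDr.
  by rewrite sumr_ge0// => j _; rewrite exprn_ge0.
exists (\sum_(0 <= m < M1) b m + (th ^+ M1 / (1 - th) + A * v M1)) => N.
have [NM|MN] := leqP N M1.
  apply: le_trans (sum_nat_widen _ _ b0 NM) _.
  rewrite lerDl; apply: addr_ge0; last exact: mulr_ge0.
  by apply: divr_ge0; [exact: exprn_ge0|rewrite subr_ge0 ltW].
rewrite (@big_cat_nat _ _ _ M1) ?(ltnW MN)//= lerD2l.
apply: le_trans (main _ M1 N (leqnn _) (leqnn _)) _.
by rewrite lerD2r sum_geometric_le.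
Qed.

Lemma sum_uniq_sub (R : realType) (T : eqType) (F : T -> R) (s u : seq T) :
  (forall z, 0 <= F z) -> uniq s -> {subset s <= u} -> \sum_(z <- s) F z <= \sum_(z <- u) F z.
Proof.
move=> F0; elim: s u => [|z s IH] u; first by rewrite big_nil sumr_ge0.
move=> /= /andP[zs us] su; have zu : z \in u by apply: su; rewrite inE eqxx.
rewrite big_cons (big_rem z zu)/= lerD2l; apply: IH => // w ws.
have wz : w != z by apply: contraNneq zs => <-.
by have := su w; rewrite inE ws orbT (perm_mem (perm_to_rem zu)) inE (negbTE wz) => /(_ isT).
Qed.

(** Cauchy condensation: the block from [2^j] to [2^(j+1)] contributes at most [(2^(1 - p))^j]. *)
Lemma sum_powR_bounded (R : realType) (p : R) : 1 < p ->
  exists2 Z, 0 < Z & forall K, \sum_(1 <= k < K) k%:R `^ (- p) <= Z.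
Proof.
move=> p1; pose q : R := 2 `^ (1 - p).
have q0 : 0 < q by rewrite powR_gt0.
have q1 : q < 1.
  by rewrite /q /powR gt_eqF// -[ltRHS]expR0 ltr_expR nmulr_rlt0 ?subr_lt0// ln_gt0// ltr1n.
have q1' : 0 < 1 - q by rewrite subr_gt0.
exists (1 / (1 - q)); first by rewrite divr_gt0.
have F0 k : 0 <= k%:R `^ (- p) :> R by exact: powR_ge0.
have H j : \sum_(1 <= k < 2 ^ j) k%:R `^ (- p) <= \sum_(0 <= i < j) q ^+ i.
  elim: j => [|j IH]; first by rewrite !big_geq.
  rewrite (@big_cat_nat _ _ _ (2 ^ j)%N) ?expn_gt0 ?leq_exp2l//= big_nat_recr//=.
  apply: lerD => //.
  apply: (@le_trans _ _ (\sum_(2 ^ j <= k < 2 ^ j.+1) (2 ^ j)%:R `^ (- p))).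
    rewrite big_nat_cond [leRHS]big_nat_cond; apply: ler_sum => k /andP[/andP[jk _] _].
    by apply: powR_nat_decr => //; [exact: lt_trans p1|rewrite expn_gt0].
  rewrite sumr_const_nat expnS mul2n -addnn addnK -[leLHS]mulr_natl.
  have e0 : 0 < (2 ^ j)%:R :> R by rewrite ltr0n expn_gt0.
  rewrite -{1}(powRr1 (ltW e0)) -powRD; last by apply/implyP => _; rewrite gt_eqF.
  by rewrite natrX -powR_mulrn// -powRrM mulrC powRrM powR_mulrn// powR_ge0.
move=> K; have KK : (K <= 2 ^ K)%N by rewrite ltnW// ltn_expl.
apply: le_trans (sum_nat_widen _ _ F0 KK) _; apply: le_trans (H K) _.
by apply: le_trans (sum_geometric_le _ _ (ltW q0) q1) _; rewrite expr0.
Qed.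

Lemma bigmin_seqP (R : realType) (T : eqType) (f : T -> R) (s : seq T) (a : R) :
  let m := \big[Order.min/a]_(z <- s) f z in
  [/\ m <= a, {in s, forall z, m <= f z} & m = a \/ exists2 z, z \in s & m = f z].
Proof.
move=> m; rewrite {}/m; elim: s => [|z s [IH1 IH2 IH3]]; rewrite ?big_nil ?big_cons.
  by split=> //; left.
split; first by rewrite ge_min IH1 orbT.
  move=> w; rewrite inE => /orP[/eqP->|ws]; first by rewrite ge_min lexx.
  by rewrite ge_min IH2// orbT.
case: leP => _; first by right; exists z; rewrite ?inE ?eqxx.
case: IH3 => [->|[w ws ->]]; first by left.
by right; exists w; rewrite ?inE ?ws ?orbT.
Qed.

(** * Distances of the multiples of x to the integers *)

Section min_dist.
Variables (R : realType) (x : R).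
Hypothesis ix : irrational x.

Let d (q : nat) : R := int_dist (q%:R * x).

(** The default 1 exceeds every distance to the integers, so it is the value only when the range is
    empty, that is for [m = 0]. *)
Definition min_dist (m : nat) : R :=
  \big[Order.min/1]_(q <- index_iota 1 (2 ^ m)) int_dist (q%:R * x).

Lemma min_dist_le (m q : nat) : (0 < q < 2 ^ m)%N -> min_dist m <= d q.
Proof.
have [_ h _] := bigmin_seqP d (index_iota 1 (2 ^ m)) 1.
by move=> qm; apply: h; rewrite mem_index_iota.
Qed.

Lemma min_dist_attained (m : nat) : (0 < m)%N ->
  exists2 q, (0 < q < 2 ^ m)%N & min_dist m = d q.
Proof.
move=> m0; have [_ h [h1|[q]]] := bigmin_seqP d (index_iota 1 (2 ^ m)) 1.
  have := h 1%N; rewrite mem_index_iota -(expn0 2) ltn_exp2l// m0 => /(_ isT).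
  by rewrite h1; have := int_dist_le_half (1%:R * x); rewrite /d; lra.
by rewrite mem_index_iota => qm e; exists q.
Qed.

Lemma min_dist_gt0 m : 0 < min_dist m.
Proof.
have [_ _ [|[q]]] := bigmin_seqP d (index_iota 1 (2 ^ m)) 1.
  by rewrite /min_dist => ->.
rewrite mem_index_iota => /andP[q0 _]; rewrite /min_dist => ->.
exact: int_dist_gt0.
Qed.

Lemma min_dist_noninc m : min_dist m.+1 <= min_dist m.
Proof.
have [_ _ [|[q]]] := bigmin_seqP d (index_iota 1 (2 ^ m)) 1.
  rewrite /min_dist => ->.
  by have [] := bigmin_seqP d (index_iota 1 (2 ^ m.+1)) 1.
rewrite mem_index_iota => /andP[q0 qm]; rewrite {2}/min_dist => ->.
by apply: min_dist_le; rewrite q0 (leq_trans qm)// leq_exp2l.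
Qed.

(* Two linear forms q x - p and q' x - p' that are not proportional cannot both be
   small, since q p' - q' p is then a nonzero integer. *)
Lemma min_dist_drop m : (0 < m)%N -> min_dist m.+1 < min_dist m ->
  1 <= 3 * 2 ^+ m * min_dist m.
Proof.
move=> m0 drop.
have [q /andP[q0 qm] qE] := min_dist_attained m0.
have [q' /andP[q'0 q'm] q'E] := min_dist_attained (ltn0Sn m).
have dqq : d q' < d q by rewrite -qE -q'E.
have qR : 0 < q%:R :> R by rewrite ltr0n.
have q'R : 0 < q'%:R :> R by rewrite ltr0n.
pose p := nearest_int (q%:R * x); pose p' := nearest_int (q'%:R * x).
have dE : d q = `|q%:R * x - p%:~R| by [].
have dE' : d q' = `|q'%:R * x - p'%:~R| by [].
have e : (q'%:Z * p - q%:Z * p')%:~R = q%:R * (q'%:R * x - p'%:~R) - q'%:R * (q%:R * x - p%:~R) :> R.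
  by rewrite intrB !intrM -!pmulrn; ring.
have [z0|nz] := eqVneq (q'%:Z * p - q%:Z * p') 0.
  have qd : q%:R * d q' = q'%:R * d q.
    rewrite dE dE' -[X in X * _ = _](gtr0_norm qR) -[X in _ = X * _](gtr0_norm q'R) -!normrM.
    by apply: (congr1 Num.norm); apply/eqP; rewrite -subr_eq0 -e z0.
  have qq' : (q' < q)%N.
    rewrite ltnNge; apply/negP => qq'.
    have : q%:R * d q' < q'%:R * d q.
      apply: (@lt_le_trans _ _ (q%:R * d q)); first by rewrite ltr_pM2l.
      by rewrite ler_wpM2r ?ler_nat ?normr_ge0.
    by rewrite qd ltxx.
  have : min_dist m <= d q' by apply: min_dist_le; rewrite q'0 (ltn_trans qq').
  by rewrite qE leNgt dqq.
have h1 : 1 <= `|(q'%:Z * p - q%:Z * p')%:~R| :> R.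
  by rewrite -intr_norm -[1]/(1%:~R) ler_int -gtz0_ge1 normr_gt0.
apply: (le_trans h1); rewrite e; apply: le_trans (ler_normB _ _) _.
rewrite !normrM (gtr0_norm qR) (gtr0_norm q'R) -dE -dE' qE.
have A1 : q%:R <= 2 ^+ m :> R by rewrite -natrX ler_nat ltnW.
have A2 : q'%:R <= 2 * 2 ^+ m :> R by rewrite -exprS -natrX ler_nat ltnW.
have d0 : 0 <= d q' by exact: normr_ge0.
have : q%:R * d q' <= 2 ^+ m * d q by apply: ler_pM => //; exact: ltW.
have : q'%:R * d q <= 2 * 2 ^+ m * d q by apply: ler_wpM2r => //; exact: normr_ge0.
move=> h2 h3; have -> : 3 * 2 ^+ m * d q = 2 ^+ m * d q + 2 * 2 ^+ m * d q by ring.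
exact: lerD.
Qed.

(** Put [dl = min_dist m]. Two multiples on the same side of their nearest integers have distances
    differing by at least [dl], since the difference of their indices is again an index below [2^m].
    So the side and the integer part of [d q / dl], which is at least 1, determine [q]; the two
    sides give the factor 2. *)
Lemma sum_int_dist_le (t Z : R) (m : nat) : 0 < t -> (0 < m)%N ->
  (forall K, \sum_(1 <= k < K) k%:R `^ (- t) <= Z) ->
  \sum_(1 <= q < 2 ^ m) d q `^ (- t) <= 2 * Z * min_dist m `^ (- t).
Proof.
move=> t0 m0 hZ; set dl := min_dist m; have dl0 : 0 < dl by exact: min_dist_gt0.
pose y (q : nat) := q%:R * x - (nearest_int (q%:R * x))%:~R.
have dy q : d q = `|y q| by [].
pose f (q : nat) := (0 < y q, Num.truncn (d q / dl)).
pose F (z : bool * nat) := (z.2%:R * dl) `^ (- t).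
have itv q : (f q).2%:R <= d q / dl < (f q).2.+1%:R.
  by apply: truncn_itv; rewrite divr_ge0 ?normr_ge0// ltW.
have finj : {in index_iota 1 (2 ^ m) &, injective f}.
  have H q q' : (0 < q < 2 ^ m)%N -> (0 < q' < 2 ^ m)%N -> (q < q')%N -> f q <> f q'.
    move=> qm q'm qq' /[dup] fE [sE kE].
    have : dl <= d (q' - q)%N.
      by apply: min_dist_le; rewrite subn_gt0 qq' (leq_ltn_trans (leq_subr _ _))//; case/andP: q'm.
    have : d (q' - q)%N <= `|y q' - y q|.
      have -> : y q' - y q = (q' - q)%:R * x -
          (nearest_int (q'%:R * x) - nearest_int (q%:R * x))%:~R.
        by rewrite /y natrB ?(ltnW qq')// intrB; ring.
      exact: int_dist_le.
    move=> /[swap] /le_trans /[apply]; apply/negP; rewrite -ltNge.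
    have := itv q; have := itv q'; rewrite fE !ler_pdivlMr// !ltr_pdivrMr// -natr1 !dy.
    rewrite mulrDl mul1r; move: ((f q').2%:R * dl) => w.
    move=> /andP[a1 a2] /andP[b1 b2]; move: sE a1 a2 b1 b2; case: (ltrP 0 (y q)) => yq.
      move=> /esym yq'; rewrite (gtr0_norm yq) (gtr0_norm yq').
      by move=> ? ? ? ?; rewrite ltr_norml; apply/andP; split; lra.
    move=> /esym/negbT; rewrite -leNgt => yq'; rewrite (ler0_norm yq) (ler0_norm yq').
    by move=> ? ? ? ?; rewrite ltr_norml; apply/andP; split; lra.
  move=> q q'; rewrite !mem_index_iota => qm q'm e.
  by case: (ltngtP q q') => // h; [case: (H q q' qm q'm h)|case: (H q' q q'm qm h)].
pose K := (Num.truncn dl^-1).+1.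
have f2 q : (0 < q < 2 ^ m)%N -> (0 < (f q).2 < K)%N.
  move=> qm; rewrite /f/= truncn_gt0 ler_pdivlMr// mul1r min_dist_le//= ltnS.
  apply: le_truncn; rewrite ler_pdivrMr// mulVf ?gt_eqF//.
  by apply: le_trans (int_dist_le_half _) _; lra.
apply: (@le_trans _ _ (\sum_(1 <= q < 2 ^ m) F (f q))).
  rewrite big_nat_cond [leRHS]big_nat_cond; apply: ler_sum => q /andP[qm _].
  have /andP[k0 _] := f2 q qm.
  have kd : 0 < (f q).2%:R * dl by rewrite mulr_gt0// ltr0n.
  have dq : 0 < d q by apply: int_dist_gt0 => //; case/andP: qm.
  rewrite /F !powRN lef_pV2 ?posrE ?powR_gt0//; apply: ler_powR_base; rewrite ?(ltW t0) ?(ltW kd)//.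
  by have /andP[+ _] := itv q; rewrite ler_pdivlMr.
rewrite -(big_map f xpredT F).
apply: (@le_trans _ _ (\sum_(z <- [seq (b, k) | b <- [:: true; false], k <- index_iota 1 K]) F z)).
  apply: sum_uniq_sub => [z||z].
  - exact: powR_ge0.
  - by rewrite map_inj_in_uniq ?iota_uniq.
  - move=> /mapP[q]; rewrite mem_index_iota => qm ->; apply/allpairsP; exists (f q).
    by rewrite !inE mem_index_iota f2//; split=> //; case: (f q).1.
rewrite big_allpairs !big_cons big_nil /= addr0.
have -> : 2 * Z * dl `^ (- t) = Z * dl `^ (- t) + Z * dl `^ (- t) by ring.
have E b : \sum_(k <- index_iota 1 K) F (b, k) <= Z * dl `^ (- t).
  apply: (@le_trans _ _ ((\sum_(1 <= k < K) k%:R `^ (- t)) * dl `^ (- t))); last first.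
    by rewrite ler_wpM2r ?powR_ge0.
  by rewrite mulr_suml; apply: ler_sum => k _; rewrite /F/= powRM// ltW.
exact: lerD.
Qed.

End min_dist.

Lemma powR_exprn (R : realType) (a r : R) (m : nat) :
  0 <= a -> (a ^+ m) `^ r = (a `^ r) ^+ m.
Proof.
by move=> a0; rewrite -powR_mulrn// -powRrM mulrC powRrM powR_mulrn ?powR_ge0.
Qed.

Lemma powR2_lt1 (R : realType) (r : R) : 0 < r -> 2 `^ (- r) < 1 :> R.
Proof.
move=> r0; rewrite powRN invf_lt1 ?powR_gt0//.
have p1 : 1 `^ r = 1 :> R by rewrite powR1.
by rewrite -[ltLHS]p1 ltr_powR_base// ltr1n.
Qed.

(** On the block from [2^M] to [2^(M+1)] the factor [n^(- s)] is bounded at the left end, but the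
    distances by the minimum below the right end; the shift of one index costs [2^s]. *)
Lemma sum_term_le (R : realType) (s t x Z : R) (M : nat) :
  0 < s -> 0 < t -> irrational x ->
  (forall K, \sum_(1 <= k < K) k%:R `^ (- t) <= Z) ->
  \sum_(1 <= q < 2 ^ M) term s t x q <=
  2 * Z * 2 `^ s * \sum_(0 <= m < M.+1) (2 `^ (- s)) ^+ m * min_dist x m `^ (- t).
Proof.
move=> s0 t0 ix hZ.
have Z0 : 0 <= Z by have := hZ 1%N; rewrite big_geq.
have b0 m : 0 <= (2 `^ (- s)) ^+ m * min_dist x m `^ (- t).
  by rewrite mulr_ge0 ?exprn_ge0 ?powR_ge0.
have A0 : 0 <= 2 * Z * 2 `^ s :> R by rewrite !mulr_ge0 ?powR_ge0.
elim: M => [|M IH]; first by rewrite big_geq// mulr_ge0// sumr_ge0.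
rewrite (@big_cat_nat _ _ _ (2 ^ M)%N) ?expn_gt0 ?leq_exp2l//=.
rewrite [in leRHS]big_nat_recr//= mulrDr; apply: lerD => //.
apply: (@le_trans _ _ ((2 `^ (- s)) ^+ M *
    \sum_(2 ^ M <= q < 2 ^ M.+1) int_dist (q%:R * x) `^ (- t))).
  rewrite mulr_sumr big_nat_cond [leRHS]big_nat_cond; apply: ler_sum => q /andP[/andP[Mq _] _].
  have q0 : (0 < q)%N by apply: leq_trans Mq; rewrite expn_gt0.
  have dq := int_dist_gt0 ix q0.
  rewrite /term; apply: ler_pM; rewrite ?powR_ge0//.
    by rewrite -powR_exprn// -natrX powR_nat_decr// expn_gt0.
  have dsin := int_dist_le_sin (q%:R * x).
  rewrite mulrA in dsin.
  rewrite !powRN lef_pV2 ?posrE ?powR_gt0//; last exact: lt_le_trans dq dsin.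
  by apply: ler_powR_base => //; exact: ltW.
have -> : 2 * Z * 2 `^ s * ((2 `^ (- s)) ^+ M.+1 * min_dist x M.+1 `^ (- t)) =
    (2 `^ (- s)) ^+ M * (2 * Z * min_dist x M.+1 `^ (- t)).
  by rewrite exprS powRN; field; rewrite gt_eqF// powR_gt0.
apply: ler_wpM2l; first by rewrite exprn_ge0// powR_ge0.
apply: le_trans (sum_int_dist_le ix t0 (ltn0Sn M) hZ).
rewrite [leRHS](@big_cat_nat _ _ _ (2 ^ M)%N) ?expn_gt0 ?leq_exp2l//= lerDr.
by apply: sumr_ge0 => q _; exact: powR_ge0.
Qed.

Lemma Dset_frequently (R : realType) (s t eps x : R) (M0 : nat) :
  1 < t -> t < s -> 0 < eps -> Dset s t x ->
  exists m q, [/\ (M0 <= m)%N, (0 < q < 2 ^ m)%N &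
    int_dist (q%:R * x) < (2 `^ (- (s / t))) ^+ m * m%:R `^ eps].
Proof.
move=> t1 ts eps0 /Dset_unbounded[ix unb].
have t0 : 0 < t by exact: lt_trans t1.
have s0 : 0 < s by exact: lt_trans ts.
apply: contrapT => none.
have [Z _ hZ] := sum_powR_bounded t1.
(* If the minimum drops after [m], it is at least [2^(- m) / 3], so [b m <= 2^(- s m) * (3 * 2^m)^t
   = 3^t * theta^m]; otherwise [b m.+1 = q * b m]. *)
pose q : R := 2 `^ (- s); pose theta : R := 2 `^ (- (s - t)).
pose b m := q ^+ m * min_dist x m `^ (- t).
have q0 : 0 < q by rewrite powR_gt0.
have th0 : 0 < theta by rewrite powR_gt0.
have b0 m : 0 <= b m by rewrite mulr_ge0 ?exprn_ge0 ?powR_ge0.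
have st0 : 0 < s - t by rewrite subr_gt0.
have C0 : 0 < 3 `^ t :> R by rewrite powR_gt0.
have b_le m : (M0.+1 <= m)%N -> b m <= m%:R `^ (- (eps * t)).
  move=> Mm; have m0 : (0 < m)%N by apply: leq_trans Mm.
  have mR : 0 < m%:R :> R by rewrite ltr0n.
  have [p pm pE] := min_dist_attained x m0.
  have B0 : 0 < (2 `^ (- (s / t))) ^+ m * m%:R `^ eps.
    by rewrite mulr_gt0 ?exprn_gt0 ?powR_gt0.
  have h : (2 `^ (- (s / t))) ^+ m * m%:R `^ eps <= min_dist x m.
    rewrite pE leNgt; apply/negP => lt; apply: none; exists m, p; split=> //.
    exact: ltnW.
  apply: (@le_trans _ _ (q ^+ m * ((2 `^ (- (s / t))) ^+ m * m%:R `^ eps) `^ (- t))).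
    apply: ler_wpM2l; first by rewrite exprn_ge0// ltW.
    move: B0 h; set B := _ * _ => B0 h.
    rewrite !powRN lef_pV2 ?posrE ?powR_gt0 ?min_dist_gt0//.
    by apply: ler_powR_base => //; exact: ltW.
  rewrite powRM ?exprn_ge0 ?powR_ge0// powR_exprn ?powR_ge0// -!powRrM.
  have -> : - (s / t) * - t = s by field; rewrite gt_eqF.
  rewrite mulrA -exprMn /q powRN mulVf ?expr1n ?mul1r; last by rewrite gt_eqF// powR_gt0.
  by rewrite mulrN.
have b_step m : (M0.+1 <= m)%N -> b m.+1 = q * b m \/ b m <= 3 `^ t * theta ^+ m.
  move=> Mm; have m0 : (0 < m)%N by apply: leq_trans Mm.
  have := min_dist_noninc x m; rewrite le_eqVlt => /orP[/eqP e|lt].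
    by left; rewrite /b e exprS mulrA.
  right; have h := min_dist_drop m0 lt.
  have mn0 := min_dist_gt0 ix m.
  have B0 : 0 < 3 * 2 ^+ m :> R by rewrite mulr_gt0// exprn_gt0.
  apply: (@le_trans _ _ (q ^+ m * (3 * 2 ^+ m) `^ t)).
    apply: ler_wpM2l; first by rewrite exprn_ge0// ltW.
    rewrite powRN -[leLHS]mul1r ler_pdivrMr ?powR_gt0// -powRM ?(ltW B0) ?(ltW mn0)//.
    have p1 : 1 `^ t = 1 :> R by rewrite powR1.
    by rewrite -[leLHS]p1 ler_powR_base// ltW.
  rewrite powRM ?exprn_ge0// powR_exprn// mulrCA -exprMn /q /theta.
  rewrite -powRD; last by apply/implyP.
  by rewrite opprB addrC.
have [B hB] := sum_stretches_bounded q0 (powR2_lt1 s0) th0 (powR2_lt1 st0) C0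
  (mulr_gt0 eps0 t0) b0 b_le b_step.
have [N] := unb (2 * Z * 2 `^ s * B); apply/negP; rewrite -leNgt.
have NN : (N <= 2 ^ N)%N by rewrite ltnW// ltn_expl.
apply: le_trans (sum_nat_widen _ _ (term_ge0 s t x) NN) _.
apply: le_trans (sum_term_le N s0 t0 ix hZ) _.
have Z0 : 0 <= Z by have := hZ 1%N; rewrite big_geq.
by apply: ler_wpM2l; [rewrite !mulr_ge0 ?powR_ge0|exact: hB].
Qed.

(** * Covers *)

Lemma nneseries_pair (R : realType) (F : nat * nat -> \bar R) :
  (forall z, 0 <= F z)%E -> exists2 f : nat -> nat * nat, bijective f &
  (\sum_(n <oo) F (f n) = \sum_(k <oo) \sum_(i <oo) F (k, i))%E.
Proof.
move=> F0; have /card_esym/ppcard_eqP[f] := card_nat2.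
have fbij : set_bij setT setT f by exact: bij.
exists f.
  by exists (f^-1)%FUN => z; rewrite ?funK ?invK ?inE.
rewrite nneseries_esumT// -(reindex_esum _ _ _ F fbij).
rewrite nneseries_esumT; last by move=> k; exact: nneseries_ge0.
transitivity (\esum_(k in [set: nat]) \esum_(i in [set: nat]) F (k, i))%E; last first.
  by apply: eq_esum => k _; rewrite nneseries_esumT.
rewrite (@esum_esum _ _ _ setT (fun=> setT) (fun k i => F (k, i)))//.
have -> : [set: nat] `*`` (fun=> [set: nat]) = setT.
  by apply/seteqP; split.
by apply: eq_esum => -[].
Qed.

Lemma hausdorff_pre_double_cover (R : realType) (h : R -> R) (delta : R) (A : set R)
    (V : nat -> nat -> set R) :
  (forall x, 0 <= x -> 0 <= h x) -> A `<=` \bigcup_k \bigcup_i V k i ->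
  (forall k i, (diam (V k i) <= delta%:E)%E) ->
  (hausdorff_pre h delta A <= \sum_(k <oo) \sum_(i <oo) (h (fine (diam (V k i))))%:E)%E.
Proof.
move=> h0 AV Vd.
have F0 (z : nat * nat) : (0 <= (h (fine (diam (V z.1 z.2))))%:E)%E.
  by rewrite lee_fin h0//; have [] := diamP (Vd z.1 z.2).
have [f [g fK gK] E] := nneseries_pair F0.
rewrite -E; apply: ereal_inf_lbound; exists (fun n => V (f n).1 (f n).2) => //.
split=> // x /AV[k _ [i _ Vx]]; exists (g (k, i)) => //.
by rewrite gK.
Qed.

(** This allows a restriction to bounded windows, on which each dyadic block of denominators needs
    only finitely many fractions. *)
Lemma hausdorff_pre_null_bigcup (R : realType) (h : R -> R) (delta : R)
    (A : nat -> set R) :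
  (forall x, 0 <= x -> 0 <= h x) -> (forall k, (hausdorff_pre h delta (A k) <= 0)%E) ->
  (hausdorff_pre h delta (\bigcup_k A k) <= 0)%E.
Proof.
move=> h0 A0; apply/lee_addgt0Pr => e e0; rewrite add0e.
have [V VP] : {V : nat -> nat -> set R & forall k, delta_cover delta (A k) (V k) /\
    (\sum_(i <oo) (h (fine (diam (V k i))))%:E <= (e / (2 ^ k.+1)%:R)%:E)%E}.
  apply: (@choice _ _ (fun k W => delta_cover delta (A k) W /\
    (\sum_(i <oo) (h (fine (diam (W i))))%:E <= (e / (2 ^ k.+1)%:R)%:E)%E)) => k.
  have ek : (0 < (e / (2 ^ k.+1)%:R)%:E)%E.
    by rewrite lte_fin divr_gt0// ltr0n expn_gt0.
  have /ereal_inf_lt[_ [W WA <-] Wlt] := le_lt_trans (A0 k) ek.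
  by exists W; split=> //; exact: ltW.
apply: (@le_trans _ _ (\sum_(k <oo) \sum_(i <oo) (h (fine (diam (V k i))))%:E)%E).
  apply: hausdorff_pre_double_cover => //.
    move=> x [k _ Ax]; exists k => //; have [[AV _] _] := VP k.
    exact: AV.
  by move=> k i; have [[_ Vd] _] := VP k.
apply: le_trans (epsilon_trick0 xpredT (ltW e0)).
apply: lee_nneseries => [k *|k *]; last by have [] := VP k.
apply: nneseries_ge0 => i *; rewrite lee_fin h0//.
by have [[_ Vd] _] := VP k; have [] := diamP (Vd i).
Qed.

Definition psi (R : realType) (rho eps : R) (m : nat) : R := rho ^+ m * m%:R `^ eps.

Section psi.
Variables (R : realType) (rho eps : R).
Hypothesis rho_gt0 : 0 < rho.
Hypothesis rho_half : 2 * rho < 1.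
Hypothesis eps_gt0 : 0 < eps.
Hypothesis eps_le1 : eps <= 1.

Lemma psi_ge0 m : 0 <= psi rho eps m.
Proof. by rewrite mulr_ge0 ?powR_ge0// exprn_ge0// ltW. Qed.

Lemma psi_step m : (0 < m)%N -> psi rho eps m.+1 <= psi rho eps m.
Proof.
move=> m0; rewrite /psi exprS mulrAC [leRHS]mulrC.
apply: ler_wpM2r; first by rewrite exprn_ge0// ltW.
apply: (@le_trans _ _ (rho * (2 * m%:R `^ eps))).
  rewrite ler_pM2l//; apply: (@le_trans _ _ ((2 * m%:R) `^ eps)).
    apply: ler_powR_base => //; first exact: ltW.
    by rewrite -natrM ler_nat mul2n -addnn -addn1 leq_add2l.
  by rewrite powRM// ler_wpM2r ?powR_ge0// ler1_powR// ler1n.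
by rewrite mulrA [rho * 2]mulrC ler_piMl ?powR_ge0// ltW.
Qed.

Lemma psi_noninc m n : (0 < m)%N -> (m <= n)%N -> psi rho eps n <= psi rho eps m.
Proof.
move=> m0; elim: n => [|n IH]; first by rewrite leqNgt m0.
rewrite leq_eqVlt => /orP[/eqP->//|]; rewrite ltnS => mn.
by apply: le_trans (IH mn); apply: psi_step; exact: leq_trans mn.
Qed.

Lemma psi_le_expr m : (0 < m)%N -> psi rho eps m <= (2 * rho) ^+ m.
Proof.
move=> m0; rewrite /psi exprMn [leLHS]mulrC; apply: ler_wpM2r; first by rewrite exprn_ge0// ltW.
apply: le_trans (ler1_powR _ eps_le1) _; first by rewrite ler1n.
by rewrite -natrX ler_nat ltnW// ltn_expl.
Qed.

End psi.

(** The [q] given by [Dset_frequently] may be far below [2^m], whereas the cover needs its exact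
    dyadic block [j <= m]. Since [psi] is nonincreasing, the bound survives the passage to [j]; and
    [j] is still large, because a distance below [min_dist x M0] forces [q >= 2^M0]. *)
Lemma Dset_frequently_dyadic (R : realType) (s t eps x : R) (M0 : nat) :
  1 < t -> t < s -> 0 < eps -> eps <= 1 -> Dset s t x ->
  exists m q, [/\ (M0 <= m)%N, (0 < m)%N, (2 ^ m.-1 <= q < 2 ^ m)%N &
    int_dist (q%:R * x) < psi (2 `^ (- (s / t))) eps m].
Proof.
move=> t1 ts eps0 eps1 xD; set rho := 2 `^ _.
have t0 : 0 < t by exact: lt_trans t1.
have rho0 : 0 < rho by rewrite powR_gt0.
have rho2 : 2 * rho < 1.
  have st : 0 < s / t - 1 by rewrite subr_gt0 ltr_pdivlMr// mul1r.
  have := powR2_lt1 st; rewrite opprB powRB; last by apply/implyP.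
  by rewrite powRr1// /rho powRN.
have /Dset_unbounded[ix _] := xD.
have c0 := min_dist_gt0 ix M0.
have rho2_ge0 : 0 <= 2 * rho by rewrite mulr_ge0// ltW.
have [M2 hM2] := expr_small rho2_ge0 rho2 c0.
have [m [q [Mm /andP[q0 qm] dq]]] := Dset_frequently (maxn 1 M2) t1 ts eps0 xD.
move: Mm; rewrite geq_max => /andP[m0 M2m].
have psi_le : psi rho eps m <= min_dist x M0.
  apply: le_trans (psi_le_expr rho0 eps1 m0) _; exact: hM2.
pose j := (trunc_log 2 q).+1.
have /andP[jq qj] : (2 ^ j.-1 <= q < 2 ^ j)%N by exact: trunc_log_bounds.
have M0j : (M0 < j)%N.
  rewrite -(ltn_exp2l _ _ (isT : 1 < 2)%N); apply: leq_ltn_trans qj.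
  rewrite leqNgt; apply/negP => qM; have := @min_dist_le _ x M0 q; rewrite q0 qM => /(_ isT).
  by apply/negP; rewrite -ltNge; exact: lt_le_trans dq psi_le.
have jm : (j <= m)%N by rewrite -(ltn_exp2l _ _ (isT : 1 < 2)%N) (leq_ltn_trans jq).
exists j, q; split=> //; first exact: ltnW.
  by rewrite jq qj.
exact: lt_le_trans dq (psi_noninc rho0 rho2 eps0 eps1 (ltn0Sn _) jm).
Qed.

Lemma tail_small (R : realType) (u : nat -> R) (Z e : R) :
  (forall k, 0 <= u k) -> (forall K, \sum_(1 <= k < K) u k <= Z) -> 0 < e ->
  exists M, forall N, \sum_(M <= k < N) u k <= e.
Proof.
move=> u0 uZ e0; pose E : set R := range (fun K => \sum_(1 <= k < K) u k).
have supE : has_sup E.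
  split; first by exists (\sum_(1 <= k < 0) u k), 0%N.
  by exists Z => _ [K _ <-].
have [_ [M _ <-] hM] := sup_adherent e0 supE.
exists (maxn 1 M) => N; have [NM|MN] := leqP N (maxn 1 M).
  by rewrite big_geq// ltW.
have : \sum_(1 <= k < N) u k <= sup E.
  by apply: ub_le_sup; [case: supE|exists N].
rewrite (@big_cat_nat _ _ _ (maxn 1 M)) ?leq_maxl ?(ltnW MN)//=.
have := sum_nat_widen xpredT 1 u0 (leq_maxr 1 M).
move: hM; move: (\sum_(1 <= k < M) _) (\sum_(1 <= k < maxn 1 M) _) (sup E).
by move: (\sum_(maxn 1 M <= k < N) _) => a b c d; lra.
Qed.

Lemma diam_ball_le (R : realType) (U : set R) (c r : R) : 0 <= r ->
  U `<=` [set y | `|y - c| <= r] -> (diam U <= (2 * r)%:E)%E.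
Proof.
move=> r0 Uc; apply: ge_ereal_sup => _ [->|[x Ux [y Uy <-]]].
  by rewrite lee_fin mulr_ge0.
rewrite lee_fin; have := Uc _ Ux; have := Uc _ Uy => /= hy hx.
have -> : x - y = (x - c) - (y - c) by ring.
by apply: le_trans (ler_normB _ _) _; lra.
Qed.

Lemma diam_set0 (R : realType) : diam (set0 : set R) = 0%E.
Proof.
apply/eqP; rewrite eq_le; apply/andP; split.
  by apply: ge_ereal_sup => _ [->|[x []]].
by apply: ereal_sup_ubound; left.
Qed.

(* The pair (numerator + B, denominator) is encoded by Euclidean division. *)
Definition frac_center (R : realType) (B i : nat) : R :=
  ((i %% B.*2.+1)%:R - B%:R) / (i %/ B.*2.+1)%:R.

Lemma frac_centerP (R : realType) (B m q : nat) (p : int) :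
  (q < 2 ^ m)%N -> (`|p| <= B)%N ->
  exists2 i, (i < 2 ^ m * B.*2.+1)%N & frac_center R B i = p%:~R / q%:R.
Proof.
move=> qm pB; pose j := absz (p + B%:Z).
have pB0 : 0 <= p + B%:Z by move: pB; clear; lia.
have jB : (j < B.*2.+1)%N by rewrite /j; move: pB; clear; lia.
exists (q * B.*2.+1 + j)%N.
  by apply: (@leq_trans (q.+1 * B.*2.+1)); [rewrite mulSn addnC ltn_add2r|rewrite leq_mul2r qm orbT].
rewrite /frac_center modnMDl modn_small// divnMDl// divn_small// addn0.
congr (_ / _); rewrite /j pmulrn gez0_abs// intrD -pmulrn.
by ring.
Qed.

Section upper.
Variables (R : realType) (s t tau kappa eps : R).
Hypothesis t_gt1 : 1 < t.
Hypothesis t_lt_s : t < s.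
Hypothesis tauE : tau = 1 + s / t.
Hypothesis kappa_lt : kappa < -1.
Hypothesis eps_gt0 : 0 < eps.
Hypothesis eps_le1 : eps <= 1.
Hypothesis eps_small : eps * (2 / tau) < - 1 - kappa.

Let rho : R := 2 `^ (- (s / t)).
Let p : R := - (eps * (2 / tau) + kappa).

(** If [q >= 2^(m-1)] and [|q x - n| < psi m], then [x] is within this distance of [n / q]. *)
Definition cover_radius (m : nat) : R := psi rho eps m / 2 ^+ m.-1.

Let t0 : 0 < t. Proof. exact: lt_trans t_gt1. Qed.
Let st : 0 < s / t - 1. Proof. by rewrite subr_gt0 ltr_pdivlMr// mul1r. Qed.
Let tau2 : 2 < tau. Proof. by rewrite tauE; have := st; lra. Qed.
Let rho0 : 0 < rho. Proof. by rewrite powR_gt0. Qed.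

Lemma rho_half_lt : 2 * rho < 1.
Proof.
have := powR2_lt1 st; rewrite opprB powRB; last by apply/implyP.
by rewrite powRr1// /rho powRN.
Qed.

Lemma cover_radius_ge0 m : 0 <= cover_radius m.
Proof. by rewrite divr_ge0 ?exprn_ge0// psi_ge0. Qed.

Lemma cover_radiusE m : (0 < m)%N ->
  2 * cover_radius m = 4 * (2 `^ (- tau)) ^+ m * m%:R `^ eps.
Proof.
move=> m0; rewrite /cover_radius /psi.
have -> : 2 `^ (- tau) = rho / 2 :> R.
  rewrite tauE opprD powRD; last by apply/implyP.
  by rewrite powR_inv1// mulrC.
case: m m0 => // m _ /=; rewrite expr_div_n [2 ^+ m.+1]exprS; field.
by rewrite expf_neq0.
Qed.

Lemma cover_radius_le m : (0 < m)%N -> 2 * cover_radius m <= 4 * (1 / 2) ^+ m.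
Proof.
move=> m0; have h := psi_le_expr rho0 eps_le1 m0.
have h1 : psi rho eps m <= 1.
  apply: le_trans h _; apply: exprn_ile1; last exact: ltW rho_half_lt.
  by rewrite mulr_ge0// ltW.
rewrite /cover_radius; case: m m0 h h1 => // m _ _ h1 /=.
have -> : 4 * (1 / 2) ^+ m.+1 = 2 * (1 / 2 ^+ m) :> R.
  by rewrite exprS expr_div_n expr1n; field; rewrite expf_neq0.
by rewrite ler_pM2l// ler_pM2r// invr_gt0 exprn_gt0.
Qed.

(** The factor [4^m] is the order of the number of fractions of block [m] in a bounded window. The
    exponent [2 / tau] turns [2^(- tau m)] into [4^(- m)], and [m^(eps * 2 / tau + kappa) = m^(- p)]
    remains; [eps_small] says that [p > 1]. *)
Lemma cover_gauge_le m : (4 <= m)%N ->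
  4 ^+ m * log_gauge tau kappa (2 * cover_radius m) <=
  4 `^ (2 / tau) * (ln 2 / 2) `^ kappa * m%:R `^ (- p).
Proof.
move=> m4; have m0 : (0 < m)%N by exact: leq_trans m4.
have mR : 0 < m%:R :> R by rewrite ltr0n.
have tau0 : 0 < tau by exact: lt_trans tau2.
have ln2 : 0 < ln 2 :> R by rewrite ln_gt0// ltr1n.
have D0 : 0 < 2 * cover_radius m.
  by rewrite cover_radiusE// !mulr_gt0 ?exprn_gt0 ?powR_gt0.
(* As [kappa] is negative, the logarithm is needed from below: the diameter is at most
   [4 * 2^(- m)], and [m - 2 >= m / 2] for [m >= 4]. *)
have lnD : ln 2 / 2 * m%:R <= ln (1 / (2 * cover_radius m)).
  rewrite div1r lnV ?posrE// lerNr.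
  have h : 2 * cover_radius m <= expR (- ((m%:R - 2) * ln 2)).
    apply: le_trans (cover_radius_le m0) _.
    have -> : - ((m%:R - 2) * ln 2) = 2%:R * ln 2 + - (m%:R * ln 2) :> R by ring.
    rewrite expRD expRN !expRM_natl lnK ?posrE// expr_div_n expr1n div1r.
    by rewrite (_ : 2 ^+ 2 = 4 :> R)//; ring.
  move: h; rewrite -ler_ln ?posrE ?expR_gt0// expRK => /le_trans; apply.
  rewrite lerN2; have : 4 <= m%:R :> R by rewrite ler_nat.
  by move=> h; nra.
have lnpow : ln (1 / (2 * cover_radius m)) `^ kappa <= (ln 2 / 2) `^ kappa * m%:R `^ kappa.
  have l0 : 0 < ln 2 / 2 * m%:R :> R by rewrite mulr_gt0// divr_gt0.
  have [k k0 ->] : exists2 k, 0 <= k & kappa = - k.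
    by exists (- kappa); [have := kappa_lt; lra|rewrite opprK].
  rewrite -powRM ?(ltW mR) ?divr_ge0 ?(ltW ln2)//.
  rewrite !powRN lef_pV2 ?posrE ?powR_gt0//; last exact: lt_le_trans lnD.
  by apply: ler_powR_base lnD => //; exact: ltW.
rewrite /log_gauge.
have -> : (2 * cover_radius m) `^ (2 / tau) =
    4 `^ (2 / tau) * (4 ^+ m)^-1 * m%:R `^ (eps * (2 / tau)).
  rewrite cover_radiusE// powRM ?mulr_ge0 ?exprn_ge0 ?powR_ge0//.
  rewrite powRM ?exprn_ge0 ?powR_ge0// powR_exprn ?powR_ge0// -!powRrM.
  have -> : - tau * (2 / tau) = - 2%:R by field; rewrite gt_eqF.
  by rewrite powR_invn// exprVn (_ : 2 ^+ 2 = 4 :> R)//; ring.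
have B0 : 0 < 4 ^+ m :> R by rewrite exprn_gt0.
have -> : 4 `^ (2 / tau) * (ln 2 / 2) `^ kappa * m%:R `^ (- p) =
   4 ^+ m * (4 `^ (2 / tau) * (4 ^+ m)^-1 * m%:R `^ (eps * (2 / tau)) *
   ((ln 2 / 2) `^ kappa * m%:R `^ kappa)) :> R.
  rewrite /p opprK powRD; last by apply/implyP => _; rewrite gt_eqF.
  by field; rewrite gt_eqF.
by rewrite ler_pM2l// ler_wpM2l// !mulr_ge0 ?powR_ge0 ?invr_ge0// ltW.
Qed.

End upper.

Lemma nneseries_le_finite (R : realType) (u : nat -> R) (N : nat) (c : R) :
  (forall i, 0 <= u i) -> (forall i, (i < N)%N -> u i <= c) ->
  (forall i, (N <= i)%N -> u i = 0) -> (\sum_(i <oo) (u i)%:E <= (N%:R * c)%:E)%E.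
Proof.
move=> u0 uc uN.
have uNc : \sum_(0 <= i < N) u i <= N%:R * c.
  rewrite mulr_natl -[N in leRHS]subn0 -sumr_const_nat.
  by rewrite big_nat_cond [leRHS]big_nat_cond; apply: ler_sum => i /andP[/andP[_ /uc]].
apply: nneseries_le_bound => // n; have [nN|Nn] := leqP n N.
  exact: le_trans (sum_nat_widen _ _ u0 nN) uNc.
rewrite (@big_cat_nat _ _ _ N) ?(ltnW Nn)//= [X in _ + X]big_nat_cond.
by rewrite [X in _ + X]big1 ?addr0// => i /andP[/andP[/uN]].
Qed.

Lemma frac_count_le (R : realType) (k m : nat) :
  (2 ^ m * (k.+1 * 2 ^ m).*2.+1)%:R <= (2 * k + 3)%:R * 4 ^+ m :> R.
Proof.
rewrite -natrX -natrM ler_nat (_ : 4 ^ m = 2 ^ m * 2 ^ m)%N; last by rewrite -expnMn.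
by have : (0 < 2 ^ m)%N by [rewrite expn_gt0]; move: (2 ^ m)%N => z; nia.
Qed.

Lemma Dset_window_null (R : realType) (s t tau kappa eps delta : R) (h : R -> R) (k : nat) :
  1 < t -> t < s -> tau = 1 + s / t -> kappa < -1 -> 0 < eps -> eps <= 1 ->
  eps * (2 / tau) < - 1 - kappa -> log_dimension_function tau kappa h -> 0 < delta ->
  (hausdorff_pre h delta (Dset s t `&` [set x | (`|x| <= k%:R)%R]) <= 0)%E.
Proof.
move=> t1 ts tauE k1 eps0 eps1 eps_s [[h0 hmono _] [r0 [r00 _ _ hE]]] delta0.
have h_ge0 x : 0 <= x -> 0 <= h x.
  by move=> x0; rewrite -h0 hmono// in_itv/= ?lexx ?x0.
pose cr := cover_radius s t eps.
have cr0 m : 0 <= cr m by exact: cover_radius_ge0.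
have cr_le m : (0 < m)%N -> 2 * cr m <= 4 * (1 / 2) ^+ m.
  exact: cover_radius_le.
pose p : R := - (eps * (2 / tau) + kappa).
pose K : R := 4 `^ (2 / tau) * (ln 2 / 2) `^ kappa.
have K0 : 0 <= K by rewrite mulr_ge0 ?powR_ge0.
have cg m : (4 <= m)%N -> 4 ^+ m * log_gauge tau kappa (2 * cr m) <= K * m%:R `^ (- p).
  exact: cover_gauge_le.
have p1 : 1 < p by rewrite /p; lra.
apply/lee_addgt0Pr => e e0; rewrite add0e.
pose C : R := (2 * k + 3)%:R * K.
have C0 : 0 <= C by rewrite mulr_ge0.
have [Z _ hZ] := sum_powR_bounded p1.
have e1 : 0 < e / (C + 1) by rewrite divr_gt0// ltr_wpDl.
have [M2 hM2] := tail_small (fun i => powR_ge0 i%:R (- p)) hZ e1.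
(* The division by 4 compensates the factor 4 in [cr_le]; [r0 / 2] makes the diameters strictly
   smaller than [r0], where [h] is the logarithmic gauge. *)
have d0 : 0 < Num.min delta (r0 / 2) / 4.
  by rewrite divr_gt0// lt_min delta0 divr_gt0.
have half0 : 0 <= 1 / 2 :> R by rewrite divr_ge0.
have half1 : 1 / 2 < 1 :> R by rewrite ltr_pdivrMr// mul1r ltr1n.
have [M1 hM1] := expr_small half0 half1 d0.
pose M := maxn 4 (maxn M1 M2).
have MP m : (M <= m)%N -> [/\ (4 <= m)%N, (M1 <= m)%N & (M2 <= m)%N].
  by rewrite !geq_max => /and3P[].
have cr_small m : (M <= m)%N -> 2 * cr m <= delta /\ 2 * cr m < r0.
  move=> /MP[m4 /hM1 h1 _]; have h2 := cr_le m (leq_trans (isT : 0 < 4)%N m4).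
  have : 2 * cr m <= Num.min delta (r0 / 2).
    by apply: le_trans h2 _; rewrite mulrC -ler_pdivlMr.
  by rewrite le_min => /andP[? ?]; split=> //; lra.
(* For [|x| <= k] and [q < 2^m], the integer nearest to [q x] has absolute value at most
   [k * 2^m + 1 / 2]. *)
pose B m := (k.+1 * 2 ^ m)%N.
pose N m := (2 ^ m * (B m).*2.+1)%N.
pose V m i : set R := if (M <= m)%N && (i < N m)%N
  then [set y | `|y - frac_center R (B m) i| <= cr m] else set0.
have Vd m i : (diam (V m i) <= (2 * cr m)%:E)%E.
  rewrite /V; case: ifP => _; first by apply: (@diam_ball_le _ _ (frac_center R (B m) i)).
  by rewrite diam_set0 lee_fin mulr_ge0.
apply: le_trans (hausdorff_pre_double_cover (V := V) h_ge0 _ _) _.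
- move=> x [xD xk].
  have [m [q [Mm m0 /andP[mq qm] dq]]] := Dset_frequently_dyadic M t1 ts eps0 eps1 xD.
  have q0 : 0 < q%:R :> R by rewrite ltr0n (leq_trans _ mq)// expn_gt0.
  pose n := nearest_int (q%:R * x).
  have nB : (`|n| <= B m)%N.
    rewrite -(ler_nat R) natr_absz intr_norm.
    have -> : n%:~R = q%:R * x - (q%:R * x - n%:~R) :> R by ring.
    apply: le_trans (ler_normB _ _) _; rewrite normrM (gtr0_norm q0).
    have h1 := int_dist_le_half (q%:R * x).
    have h2 : q%:R * `|x| <= q%:R * k%:R by rewrite ler_pM2l.
    have h3 : q%:R * k%:R <= (2 ^ m)%:R * k%:R :> R by rewrite ler_wpM2r// ler_nat ltnW.
    have h4 : 1 <= (2 ^ m)%:R :> R by rewrite ler1n expn_gt0.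
    rewrite -/(int_dist _) natrM -natr1.
    move: (int_dist _) (q%:R * `|x|) (q%:R * k%:R) h1 h2 h3 => a b c h1 h2 h3; lra.
  have [i iN iE] := frac_centerP R qm nB.
  exists m => //; exists i => //; rewrite /V Mm iN /= iE.
  have -> : x - n%:~R / q%:R = (q%:R * x - n%:~R) / q%:R by field; rewrite gt_eqF.
  rewrite normrM normfV (gtr0_norm q0) ler_pdivrMr// -/(int_dist _).
  apply: le_trans (ltW dq) _; rewrite /cr /cover_radius mulrAC ler_pdivlMr ?exprn_gt0//.
  apply: ler_wpM2l; last by rewrite -natrX ler_nat.
  by apply: psi_ge0; rewrite powR_gt0.
- move=> m i; have [Mm|mM] := leqP M m.
    by apply: le_trans (Vd m i) _; rewrite lee_fin; case: (cr_small m Mm).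
  by rewrite /V leqNgt mM/= diam_set0 lee_fin ltW.
have dP m i := diamP (Vd m i).
have w0 m i : (0 <= (h (fine (diam (V m i))))%:E)%E.
  by rewrite lee_fin h_ge0//; case: (dP m i).
pose w m := if (M <= m)%N then C * m%:R `^ (- p) else 0.
apply: (@le_trans _ _ (\sum_(m <oo) (w m)%:E)%E).
  apply: lee_nneseries => [m *|m *]; first exact: nneseries_ge0.
  rewrite /w; have [Mm|mM] := leqP M m; last first.
    rewrite eseries0// => i *.
    by rewrite /V leqNgt mM/= diam_set0/= h0.
  apply: le_trans (@nneseries_le_finite R _ (N m) (h (2 * cr m)) _ _ _) _.
  - by move=> i; rewrite -lee_fin.
  - move=> i _; have [? ? _] := dP m i; apply: hmono => //.
      by rewrite in_itv/= andbT.
    by rewrite in_itv/= andbT mulr_ge0.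
  - by move=> i Ni; rewrite /V ltnNge Ni andbF diam_set0/= h0.
  rewrite lee_fin; have [m4 _ _] := MP m Mm; have [_ crr] := cr_small m Mm.
  have hcr0 : 0 <= h (2 * cr m) by rewrite h_ge0// mulr_ge0.
  apply: le_trans (ler_wpM2r hcr0 (frac_count_le R k m)) _.
  rewrite /C -[leLHS]mulrA -[leRHS]mulrA ler_wpM2l//; apply: le_trans _ (cg m m4).
  rewrite ler_wpM2l ?exprn_ge0//.
  have [c0|/negP c0] := boolP (0 < 2 * cr m); first by rewrite hE// in_itv/= c0.
  have -> : 2 * cr m = 0.
    by apply/eqP; move/negP: c0; rewrite lt_neqAle mulr_ge0// andbT negbK eq_sym.
  by rewrite h0 mulr_ge0// powR_ge0.
apply: nneseries_le_bound => [m|n].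
  by rewrite /w; case: ifP => // _; rewrite mulr_ge0// powR_ge0.
have [nM|Mn] := leqP n M.
  rewrite big_nat_cond big1 ?ltW// => m /andP[/andP[_ mn] _].
  by rewrite /w leqNgt (leq_trans mn nM).
rewrite (@big_cat_nat _ _ _ M) ?(ltnW Mn)//= big_nat_cond big1 ?add0r; last first.
  by move=> m /andP[/andP[_ mM] _]; rewrite /w leqNgt mM.
apply: (@le_trans _ _ (C * \sum_(M2 <= m < n) m%:R `^ (- p))).
  have M2M : (M2 <= M)%N by rewrite /M !leq_max leqnn !orbT.
  rewrite [X in _ <= C * X](@big_cat_nat _ _ _ M) ?(ltnW Mn)//= mulrDr -[leLHS]add0r; apply: lerD.
    by rewrite mulr_ge0// sumr_ge0// => m _; exact: powR_ge0.
  rewrite mulr_sumr big_nat_cond [leRHS]big_nat_cond; apply: ler_sum => m /andP[/andP[Mm _] _].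
  by rewrite /w Mm.
apply: le_trans (ler_wpM2l C0 (hM2 n)) _.
rewrite mulrCA; apply: ler_piMr; first exact: ltW.
by rewrite ler_pdivrMr ?ltr_wpDl// mul1r lerDl.
Qed.

Lemma hausdorff_Dset_null (R : realType) (s t kappa : R) (h : R -> R) :
  1 < t -> t < s -> kappa < -1 -> log_dimension_function (1 + s / t) kappa h ->
  hausdorff_measure h (Dset s t) = 0%E.
Proof.
move=> t1 ts k1 hh; have [[h0 hmono _] _] := hh.
have h_ge0 x : 0 <= x -> 0 <= h x.
  by move=> x0; rewrite -h0 hmono// in_itv/= ?lexx ?x0.
set tau := 1 + s / t in hh.
have tau0 : 0 < tau.
  have t0 : 0 < t by exact: lt_trans t1.
  by rewrite addr_gt0// divr_gt0// (lt_trans t0).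
(* With this choice [eps * (2 / tau)] is at most half of the gap [- 1 - kappa]. *)
pose eps := Num.min 1 ((- 1 - kappa) * tau / 4).
have k0 : 0 < - 1 - kappa by lra.
have eps0 : 0 < eps by rewrite lt_min ltr01 divr_gt0// mulr_gt0.
have eps1 : eps <= 1 by rewrite ge_min lexx.
have eps_s : eps * (2 / tau) < - 1 - kappa.
  apply: (@le_lt_trans _ _ ((- 1 - kappa) * tau / 4 * (2 / tau))).
    by rewrite ler_wpM2r ?ge_min ?lexx ?orbT// divr_ge0// ltW.
  have -> : (- 1 - kappa) * tau / 4 * (2 / tau) = (- 1 - kappa) / 2.
    by field; rewrite gt_eqF.
  lra.
have pre0 delta : 0 < delta -> hausdorff_pre h delta (Dset s t) = 0%E.
  move=> delta0; apply/eqP; rewrite eq_le; apply/andP; split; last first.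
    apply: le_ereal_inf_tmp => _ [U [_ Ud] <-].
    apply: nneseries_ge0 => i *; rewrite lee_fin h_ge0//.
    by case: (diamP (Ud i)).
  have -> : Dset s t = \bigcup_k (Dset s t `&` [set x | `|x| <= k%:R]).
    apply/seteqP; split=> [x xD|x [k _ []]//].
    exists (Num.truncn `|x|).+1 => //; split=> //=.
    exact/ltW/truncnS_gt.
  apply: hausdorff_pre_null_bigcup => // k.
  exact: (Dset_window_null k t1 ts (erefl tau) k1 eps0 eps1 eps_s hh delta0).
apply/cvg_lim => //; apply: (@cvg_trans _ ((fun=> 0%E) @ (0 : R)^'+)).
  by apply: near_eq_cvg; near=> d; rewrite pre0.
exact: cvg_cst.
Unshelve. all: by end_near. Qed.

Theorem theorem7p4 (R : realType) (s t tau : R)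
    (ht : 1 < t) (hst : t < s) (htau : tau = 1 + s / t)
    (kappa : R) (h : R -> R) (hh : log_dimension_function tau kappa h) :
  (kappa < -1 -> hausdorff_measure h (Dset s t) = 0%E) /\
  (-1 <= kappa -> hausdorff_measure h (Dset s t) = +oo%E).
Proof.
rewrite htau in hh; split=> hk; first exact: hausdorff_Dset_null hh.
exact: hausdorff_Dset_infinite hh.
Qed.
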